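(* Let $\lambda_u/\lambda_2\in(0,\infty)$ be arbitrary. Let $$q_{f,2}^o=\left[\sqrt{\frac{\lambda_{12}(P_{12}B_{12})^{2/\alpha}}{\mu}}\,\sqrt{p_f}-\lambda_{12}(P_{12}B_{12})^{2/\alpha}\right]_0^1,\qquad f=1,\dots,N_f,$$ with $\mu>0$ chosen so that $\sum_{f=1}^{N_f}q_{f,2}^o=N_c$; let $\bar p_{{\rm a},2}=p_{{\rm a},2}(\mathbf q_2^o)$, and let $$\underline P_{\rm off}(\mathbf q_2)=\sum_{f=1}^{N_f}\frac{p_f\,q_{f,2}}{\mathcal C_{1,\gamma_0}+\bar p_{{\rm a},2}\,\mathcal C_{2,\gamma_0}+(\bar p_{{\rm a},2}\,\mathcal C_{3,\gamma_0}+1)\,q_{f,2}}.$$ Call $\mathbf q_2=(q_{1,2},\dots,q_{N_f,2})$ feasible if $\sum_{f=1}^{N_f}q_{f,2}\le N_c$ and $0\le q_{f,2}\le1$ for all $f$. Then for every feasible $\mathbf q_2$ one has $p_{{\rm a},2}(\mathbf q_2)\le\bar p_{{\rm a},2}$ and $\underline P_{\rm off}(\mathbf q_2)\le P_{\rm off}(\mathbf q_2)$, and the maximizer of the lower bound $\underline P_{\rm off}$ over all feasible $\mathbf q_2$ is $$\underline q_{f,2}^*=\left[\frac{\sqrt{\mathcal C_{1,\gamma_0}+\bar p_{{\rm a},2}\,\mathcal C_{2,\gamma_0}}}{\sqrt\nu\,(\bar p_{{\rm a},2}\,\mathcal C_{3,\gamma_0}+1)}\sqrt{p_f}-\frac{\mathcal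 C_{1,\gamma_0}+\bar p_{{\rm a},2}\,\mathcal C_{2,\gamma_0}}{\bar p_{{\rm a},2}\,\mathcal C_{3,\gamma_0}+1}\right]_0^1,\qquad f=1,\dots,N_f,$$ where $\nu>0$ is chosen so that $\sum_{f=1}^{N_f}\underline q_{f,2}^*=N_c$.
   Context: $[x]_0^1=\max\{\min\{x,1\},0\}$. Parameters: $\lambda_1,\lambda_2,\lambda_u,P_1,P_2,B_1,B_2,\gamma_0>0$, $\alpha>2$, integer $M_1\ge1$, $M_2=1$; $\lambda_{12}=\lambda_1/\lambda_2$, $P_{12}=P_1/P_2$, $B_{12}=B_1/B_2$, $M_{12}=M_1/M_2$. $N_f$ is the number of files, $N_c$ is the cache capacity of each helper, a positive integer with $N_c\le N_f$, and $p_f=f^{-\delta}/\sum_{n=1}^{N_f}n^{-\delta}$ with $\delta>0$. ${}_2F_1$ is the Gauss hypergeometric function (analytically continued to the negative real axis), $\Gamma$ the Gamma function, and $$\mathcal C_{1,\gamma_0}=\lambda_{12}(P_{12}B_{12})^{2/\alpha}\,{}_2F_1\Big[-\tfrac2\alpha,M_1;1-\tfrac2\alpha;-\tfrac{\gamma_0}{M_{12}B_{12}}\Big],\quad \mathcal C_{2,\gamma_0}=\frac{\Gamma(1-\frac2\alpha)\Gamma(M_2+\frac2\alpha)}{\Gamma(M_2)}\gamma_0^{2/\alpha},$$ $$\mathcal C_{3,\gamma_0}={}_2F_1\Big[-\tfrac2\alpha,M_2;1-\tfrac2\alpha;-\gamma_0\Big]-\mathcal C_{2,\gamma_0}-1.$$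 For a caching probability vector $\mathbf q_2\in[0,1]^{N_f}$ the probability that a helper is active and the successful offloading probability are $$p_{{\rm a},2}=p_{{\rm a},2}(\mathbf q_2)=1-\bigg(1+\frac{\lambda_u}{3.5\lambda_2}\sum_{f=1}^{N_f}\frac{p_fq_{f,2}}{\lambda_{12}(P_{12}B_{12})^{2/\alpha}+q_{f,2}}\bigg)^{-3.5},$$ $$P_{\rm off}(\mathbf q_2)=\sum_{f=1}^{N_f}\frac{p_fq_{f,2}}{\mathcal C_{1,\gamma_0}+\mathcal C_{2,\gamma_0}p_{{\rm a},2}(\mathbf q_2)+\mathcal C_{3,\gamma_0}p_{{\rm a},2}(\mathbf q_2)q_{f,2}+q_{f,2}}.$$ *)

(* Defs.v *)
From HB Require Import structures.
From mathcomp Require Import all_boot all_order all_algebra.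
From mathcomp Require Import all_classical all_reals all_analysis.

Set Implicit Arguments.
Unset Strict Implicit.
Unset Printing Implicit Defensive.

Import Order.TTheory GRing.Theory Num.Theory.
Import numFieldNormedType.Exports.

Local Open Scope classical_set_scope.
Local Open Scope ring_scope.

(* The Gamma function; the integral converges only for [0 < x]. *)
Definition Gamma (R : realType) (x : R) : R :=
  \int[lebesgue_measure]_(t in `]0, +oo[) (t `^ (x - 1) * expR (- t)).

Definition pochhammer (R : realType) (a : R) (n : nat) : R :=
  \prod_(i < n) (a + i%:R).

Definition hyp2F1_coef (R : realType) (a b c : R) (n : nat) : R :=
  pochhammer a n * pochhammer b n / (pochhammer c n * n`!%:R).

Definition real_analytic_at (R : realType) (f : R -> R) (x0 : R) : Prop :=
  exists (u : R^nat) (r : R), 0 < r /\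
    forall x, `|x - x0| < r -> pseries u (x - x0) @ \oo --> f x.

Definition is_hyp2F1 (R : realType) (a b c : R) (F : R -> R) : Prop :=
  (forall z, `|z| < 1 -> pseries (hyp2F1_coef a b c) z @ \oo --> F z) /\
  (forall z, z < 1 -> real_analytic_at F z).

(* The Gauss hypergeometric function, continued analytically from ]-1, 1[ to
   ]-oo, 1[.  If [c] is not a nonpositive integer, a function satisfying
   [is_hyp2F1] exists and is unique on ]-oo, 1[ by the identity theorem; the
   values at [z >= 1] are irrelevant. *)
Definition hyp2F1 (R : realType) (a b c : R) : R -> R :=
  xget (fun=> 0) [set F | is_hyp2F1 a b c F].

Definition clip01 (R : realType) (x : R) : R := Num.max (Num.min x 1) 0.

(* [lambda1], [lambda2]: densities of macro base stations and helpers;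
   [lambdau]: density of users; [P1], [P2]: transmit powers;
   [B1], [B2]: association biases; [gamma0]: SIR threshold;
   [alpha]: path-loss exponent; [M1], [M2]: numbers of antennas;
   [delta]: exponent of the Zipf popularity law. *)
Record params (R : realType) := Params {
  lambda1 : R; lambda2 : R; lambdau : R;
  P1 : R; P2 : R;
  B1 : R; B2 : R;
  gamma0 : R;
  alpha : R;
  M1 : nat; M2 : nat;
  delta : R
}.

Section Offloading.
Context (R : realType) (s : params R).

Definition lambda12 : R := lambda1 s / lambda2 s.
Definition P12 : R := P1 s / P2 s.
Definition B12 : R := B1 s / B2 s.
Definition M12 : R := (M1 s)%:R / (M2 s)%:R.

Definition kappa : R := lambda12 * (P12 * B12) `^ (2 / alpha s).

Definition C1 : R :=
  kappa * hyp2F1 (- (2 / alpha s)) (M1 s)%:R (1 - 2 / alpha s)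
            (- (gamma0 s / (M12 * B12))).

Definition C2 : R :=
  Gamma (1 - 2 / alpha s) * Gamma ((M2 s)%:R + 2 / alpha s)
    / Gamma (M2 s)%:R * gamma0 s `^ (2 / alpha s).

Definition C3 : R :=
  hyp2F1 (- (2 / alpha s)) (M2 s)%:R (1 - 2 / alpha s) (- gamma0 s) - C2 - 1.

Variable Nf : nat.

(* File number [f] (counted from 1) is the ordinal of value [f - 1]. *)
Definition popularity (f : 'I_Nf) : R :=
  f.+1%:R `^ (- delta s) / \sum_(n < Nf) n.+1%:R `^ (- delta s).

(* 7 / 2 is the constant 3.5 of the cell-load approximation. *)
Definition active_prob (q : 'rV[R]_Nf) : R :=
  1 - (1 + lambdau s / (7 / 2 * lambda2 s) *
        \sum_(f < Nf) popularity f * q 0 f / (kappa + q 0 f)) `^ (- (7 / 2)).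

Definition P_off (q : 'rV[R]_Nf) : R :=
  \sum_(f < Nf) popularity f * q 0 f /
    (C1 + C2 * active_prob q + C3 * active_prob q * q 0 f + q 0 f).

Definition feasible (Nc : nat) (q : 'rV[R]_Nf) : Prop :=
  \sum_(f < Nf) q 0 f <= Nc%:R /\ forall f, 0 <= q 0 f <= 1.

Definition q_o (mu : R) : 'rV[R]_Nf :=
  \row_f clip01 (Num.sqrt (kappa / mu) * Num.sqrt (popularity f) - kappa).

(* In the next two definitions [pbar] stands for [active_prob (q_o mu)]. *)
Definition P_off_lower (pbar : R) (q : 'rV[R]_Nf) : R :=
  \sum_(f < Nf) popularity f * q 0 f /
    (C1 + pbar * C2 + (pbar * C3 + 1) * q 0 f).

Definition q_star (pbar nu : R) : 'rV[R]_Nf :=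
  \row_f clip01
    (Num.sqrt (C1 + pbar * C2) / (Num.sqrt nu * (pbar * C3 + 1))
       * Num.sqrt (popularity f)
     - (C1 + pbar * C2) / (pbar * C3 + 1)).

End Offloading.

(* [x] is the maximizer, i.e. the unique maximum point, of [F] on [D]. *)
Definition is_maximizer (R : realType) (T : Type) (F : T -> R) (D : T -> Prop)
    (x : T) : Prop :=
  [/\ D x, forall y, D y -> F y <= F x
         & forall y, D y -> F y = F x -> y = x].

(* Main.v *)
Require Import Defs.
From HB Require Import structures.
From mathcomp Require Import all_boot all_order all_algebra.
From mathcomp Require Import all_classical all_reals all_analysis measurable_realfun.
From mathcomp Require Import ring lra.

(** Put [s = 2 / alpha].  The function [F z = 2F1(- s, M; 1 - s; z)] is the
    solution, regular at [0], of [z F' - s F = - s (1 - z) ^ (- M)].  On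
    [z < 0] Pfaff's transformation writes it as [(1 - z) ^ (- M)] times a power
    series in [z / (z - 1)] with coefficients at least [1], which gives
    [C1 > 0] and [C2 + C3 >= 0].  For [M = 1], [x ^ (- s) F (- x)] decreases
    towards the integral of [v ^ s / (1 + v) ^ 2] over [v > 0], which is
    [Gamma (1 - s) * Gamma (1 + s)] by Tonelli's theorem; hence [C3 >= - 1].
    So all denominators are positive and nondecreasing in the active
    probability.  Finally a sum of functions [p q / (a + b q)] with [a, b > 0]
    is maximized under a budget by maximizing the Lagrangian term by term; with
    [a = kappa], [b = 1] this shows that [q_o] maximizes the active
    probability. *)

Set Implicit Arguments.
Unset Strict Implicit.
Unset Printing Implicit Defensive.

Import Order.TTheory GRing.Theory Num.Theory.
Import numFieldNormedType.Exports.

Local Open Scope classical_set_scope.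
Local Open Scope ring_scope.

(** * Power series *)

Section PowerSeries.
Context {R : realType}.
Implicit Types (u v : R^nat) (x r : R).

(** The third hypergeometric parameter exceeds the first by one, so [(- s)_n / (1 - s)_n] collapses
    to [- s / (n - s)]; this is why a first-order equation replaces the usual second-order one.
    [hyp2F1] is a choice among all functions meeting a specification, so nothing can be read off it
    before a continuation has been exhibited; an identity theorem then forces the chosen function to
    agree with it. The specification demands analyticity at every point below [1], whereas Pfaff's
    form is a power series in another variable. The Taylor series at a nonzero point is therefore
    rebuilt from the differential equation, with crude bounds, since any positive radius will do.
    The equation is singular at [0], where the defining series takes over. On the Gamma side only an
    upper bound for the product is needed, hence the one-sided integral estimates. The bound [- 1]
    for [C3] is what the second denominator coefficient asks for: the active probability is strictly
    below [1], so [pbar * C3 + 1] stays positive. *)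

Definition has_radius u r := forall x, `|x| < r -> cvgn (pseries u x).

Lemma cvg_pseries_bound u (K rho : R) x :
  (forall n, `|u n| <= K * rho ^+ n) -> 0 <= rho -> rho * `|x| < 1 ->
  cvgn (pseries u x).
Proof.
move=> uK rho0 rx; apply: normed_cvg.
apply: (@series_le_cvg _ _ (geometric K (rho * `|x|))).
- by move=> n /=.
- move=> n /=; rewrite mulr_ge0 ?exprn_ge0 ?mulr_ge0//.
  by have := uK 0; rewrite expr0 mulr1; apply: le_trans.
- by move=> n /=; rewrite normrM normrX exprMn mulrA ler_wpM2r ?exprn_ge0.
- by apply: is_cvg_geometric_series; rewrite normrM normr_id ger0_norm.
Qed.

Lemma geometric_bound_ratio u (rho : R) N : 0 < rho ->
  (forall n, (N <= n)%N -> `|u n.+1| <= rho * `|u n|) ->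
  exists K, forall n, `|u n| <= K * rho ^+ n.
Proof.
(* The sum dominates each of the first [N.+1] normalized terms; from index [N] on the ratio
   hypothesis carries the bound along. *)
move=> rho0 ur; exists (\sum_(i < N.+1) `|u i| * rho ^- i) => n.
have small m : (m <= N)%N ->
    `|u m| <= (\sum_(i < N.+1) `|u i| * rho ^- i) * rho ^+ m.
  rewrite -ltnS => mN; rewrite (bigD1 (Ordinal mN))//= mulrDl.
  rewrite -mulrA mulVf ?mulr1 ?lerDl ?expf_neq0 ?gt_eqF//.
  apply: mulr_ge0; last by rewrite exprn_ge0// ltW.
  by apply: sumr_ge0 => i _; rewrite mulr_ge0// invr_ge0 exprn_ge0// ltW.
case: (leqP n N) => [|/ltnW Nn]; first exact: small.
rewrite -(subnKC Nn); elim: (n - N)%N => [|m IH]; first by rewrite addn0 small.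
rewrite addnS (le_trans (ur _ (leq_addr _ _)))//.
by rewrite exprS mulrCA ler_pM2l.
Qed.

Lemma has_radius_ratio u r : 0 < r ->
  (forall rho, r^-1 < rho -> exists N, forall n, (N <= n)%N ->
    `|u n.+1| <= rho * `|u n|) ->
  has_radius u r.
Proof.
move=> r0 ur x xr.
have [y /andP[xy yr]] : exists y, `|x| < y < r by exists ((`|x| + r) / 2); lra.
have y0 : 0 < y by apply: le_lt_trans xy.
have /ur[N uN] : r^-1 < y^-1 by rewrite ltf_pV2.
have y'0 : 0 < y^-1 by rewrite invr_gt0.
have [K uK] := geometric_bound_ratio y'0 uN.
apply: (cvg_pseries_bound uK); first by rewrite invr_ge0 ltW.
by rewrite mulrC ltr_pdivrMr// mul1r.
Qed.

Lemma has_radius_geometric_bound u r (y : R) : has_radius u r -> 0 < y < r ->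
  exists K, forall n, `|u n| <= K * y^-1 ^+ n.
Proof.
move=> ur /andP[y0 yr].
have := ur y; rewrite gtr0_norm// => /(_ yr) cu.
have [K [_ uK]] := cvg_series_bounded cu.
exists (K + 1) => n.
have := uK (K + 1) (ltac:(by rewrite ltrDl)) n I => /=.
rewrite normrM normrX (gtr0_norm y0) => h.
by rewrite exprVn -ler_pdivrMr ?invr_gt0 ?exprn_gt0// invrK.
Qed.

(** The factor [n.+1] is absorbed by shrinking the radius: for [|x| < z < y < r] the coefficients
    are [O(y ^ (- n))], and [n.+1 * y ^ (- n)] is [O(z ^ (- n))]. *)
Lemma has_radius_diffs u r : has_radius u r -> has_radius (pseries_diffs u) r.
Proof.
move=> ur x xr.
have [y xyr] : exists y, `|x| < y < r by exists ((`|x| + r) / 2); lra.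
case/andP: (xyr) => xy yr; have y0 : 0 < y by apply: le_lt_trans xy.
have y0r : 0 < y < r by rewrite y0.
have [K uK] := has_radius_geometric_bound ur y0r.
have [z /andP[xz zy]] : exists z, `|x| < z < y by exists ((`|x| + y) / 2); lra.
have z0 : 0 < z by apply: le_lt_trans xz.
have K0 : 0 <= K by have := uK 0; rewrite expr0 mulr1; apply: le_trans.
pose w n : R := n.+1%:R * y^-1 ^+ n.
have w0 n : 0 <= w n by rewrite mulr_ge0// exprn_ge0// invr_ge0 ltW.
have [L wL] : exists L, forall n, `|w n| <= L * z^-1 ^+ n.
  (* The ratio [(n + 2) / (n + 1)] is at most [y / z] as soon as [n + 1 >= z / (y - z)]. *)
  pose N := (Num.truncn (z / (y - z))).+1.
  apply: (@geometric_bound_ratio w _ N); first by rewrite invr_gt0.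
  move=> n Nn; rewrite !ger0_norm//.
  have nz : z / (y - z) < n.+1%:R.
    apply: (@lt_le_trans _ _ N%:R); last by rewrite ler_nat (leq_trans Nn).
    exact: truncnS_gt.
  rewrite /w exprS !mulrA.
  apply: ler_wpM2r; first by rewrite exprn_ge0// invr_ge0 ltW.
  rewrite -[n.+2%:R]natr1 ler_pdivrMr// -mulrA ler_pdivlMl//.
  move: nz; rewrite ltr_pdivrMr ?subr_gt0//; lra.
have duL n : `|pseries_diffs u n| <= K * y^-1 * L * z^-1 ^+ n.
  rewrite /pseries_diffs normrM normr_nat.
  apply: (@le_trans _ _ (K * y^-1 * w n)).
    by rewrite /w mulrCA ler_wpM2l// (le_trans (uK _))// exprS mulrA.
  rewrite -(mulrA _ L) ler_wpM2l//; first by rewrite mulr_ge0// invr_ge0 ltW.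
  by rewrite -[w n]ger0_norm.
apply: (cvg_pseries_bound duL); first by rewrite invr_ge0 ltW.
by rewrite mulrC ltr_pdivrMr// mul1r.
Qed.

Lemma is_derive_pseries u r x : has_radius u r -> `|x| < r ->
  is_derive x 1 (fun x => limn (pseries u x)) (limn (pseries (pseries_diffs u) x)).
Proof.
move=> ur xr.
have [y /andP[xy yr]] : exists y, `|x| < y < r by exists ((`|x| + r) / 2); lra.
have y0 : 0 < y by apply: le_lt_trans xy.
have yr' : `|y| < r by rewrite gtr0_norm.
have dur := has_radius_diffs ur.
apply: (@pseries_snd_diffs _ _ y).
- exact: ur.
- exact: dur.
- exact: (has_radius_diffs dur).
- by rewrite (gtr0_norm y0).
Qed.

Lemma cvg_pseriesD u v x (a b : R) : pseries u x @ \oo --> a ->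
  pseries v x @ \oo --> b -> pseries (fun n => u n + v n) x @ \oo --> a + b.
Proof.
move=> ua vb; rewrite /pseries.
rewrite (_ : series _ = pseries u x \+ pseries v x); first exact: (cvgD ua vb).
apply/funext => n; rewrite /pseries /series/= -big_split/=.
by apply: eq_bigr => i _; rewrite mulrDl.
Qed.

Lemma cvg_pseriesZ u x (a c : R) : pseries u x @ \oo --> a ->
  pseries (fun n => c * u n) x @ \oo --> c * a.
Proof.
move=> ua; rewrite /pseries.
rewrite (_ : series _ = fun n => c * pseries u x n); first exact: (cvgMl_tmp ua).
apply/funext => n; rewrite /pseries /series/= mulr_sumr.
by apply: eq_bigr => i _; rewrite mulrA.
Qed.

(** The Euler operator [x d/dx] acts on coefficients as multiplication by [n]; this translates
    differential equations into recurrences. *)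
Lemma cvg_pseries_mulnX u x (a : R) : pseries (pseries_diffs u) x @ \oo --> a ->
  pseries (fun n => n%:R * u n) x @ \oo --> x * a.
Proof.
move=> da; have cda : cvgn (pseries (pseries_diffs u) x) by apply/cvg_ex; exists a.
have := pseries_diffs_equiv cda; rewrite (cvg_lim _ da)// => e.
rewrite /pseries.
rewrite (_ : series _ = fun n => x * series (fun i => i%:R * u i * x ^+ i.-1) n).
  exact: (cvgMl_tmp e).
apply/funext => n; rewrite /series/= mulr_sumr; apply: eq_bigr => -[|i] _.
  by rewrite !mul0r mulr0.
by rewrite mulrCA -exprS.
Qed.

Lemma cvg_pseries_recl u x (a : R) : pseries (u \o S) x @ \oo --> a ->
  pseries u x @ \oo --> u 0 + x * a.
Proof.
move=> ua; rewrite -cvg_shiftS.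
rewrite (_ : (fun n => _) = (fun n => u 0 + x * pseries (u \o S) x n)).
  by apply: cvgD; [exact: cvg_cst|exact: (cvgMl_tmp ua)].
apply/funext => n; rewrite /pseries/= /series/= big_nat_recl//= expr0 mulr1.
rewrite mulr_sumr; congr (_ + _); apply: eq_bigr => i _.
by rewrite exprS mulrCA.
Qed.

Lemma cvg_pseries_inj u x (a b : R) : pseries u x @ \oo --> a ->
  pseries u x @ \oo --> b -> a = b.
Proof. by move=> ua ub; rewrite -(cvg_lim _ ua)// -(cvg_lim _ ub). Qed.

Lemma pseries_at0 u : pseries u 0 @ \oo --> u 0.
Proof.
rewrite -cvg_shiftS (_ : (fun n => _) = cst (u 0)); first exact: cvg_cst.
apply/funext => n; rewrite /pseries/= /series/= big_nat_recl//= expr0 mulr1.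
by rewrite big1 ?addr0// => i _; rewrite expr0n mulr0.
Qed.

End PowerSeries.

(** * Linear differential equations and real-analytic functions *)

Section OneVariable.
Context {R : realType}.
Implicit Types (f F G B : R -> R) (u b : R^nat).

Lemma is_derive_eq_val f (x a b : R) : is_derive x 1 f a -> a = b -> is_derive x 1 f b.
Proof. by move=> + <-. Qed.

Lemma mean_value f (df : R -> R) (x y : R) : x <= y ->
  (forall z, x <= z <= y -> is_derive z 1 f (df z)) ->
  exists2 c, x <= c <= y & f y - f x = df c * (y - x).
Proof.
move=> xy fd; have [|z|c] := @MVT_segment _ f df x y xy.
- by move=> z; rewrite in_itv/= => /andP[/ltW xz /ltW zy]; apply: fd; rewrite xz.
- apply: derivable_within_continuous => t; rewrite in_itv/= => h.
  by have [] := fd _ h.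
- by rewrite in_itv/= => h e; exists c.
Qed.

Lemma ler_is_derive_ge0 f (df : R -> R) (x y : R) : x <= y ->
  (forall z, x <= z <= y -> is_derive z 1 f (df z) /\ 0 <= df z) -> f x <= f y.
Proof.
move=> xy fd.
have [z /fd[]//|c /fd[_ dc] e] := @mean_value f df x y xy.
by rewrite -subr_ge0 e mulr_ge0// subr_ge0.
Qed.

(* [(z ^ 2) `^ (- s / 2)] is [`|z| `^ (- s)] without the case split on the sign of [z]. *)
Lemma homogeneous_ode_invariant f (s x y : R) : x <= y ->
  (forall z, x <= z <= y -> z != 0 /\ is_derive z 1 f (s * f z / z)) ->
  f x * (x ^+ 2) `^ (- (s / 2)) = f y * (y ^+ 2) `^ (- (s / 2)).
Proof.
move=> xy fd; pose g z := f z * (z ^+ 2) `^ (- (s / 2)).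
have gd z : x <= z <= y -> is_derive z 1 g ((cst 0 : R -> R) z).
  move=> /fd[z0 df]; have z2 : 0 < z ^+ 2 by rewrite exprn_even_gt0.
  have d2 : is_derive z 1 (fun z : R => z ^+ 2) (2 * z).
    by apply: (is_derive_eq_val (is_deriveX 2 (is_derive_id z 1)));
      rewrite /= expr1 /GRing.scale/= mulr1.
  have dp := is_derive1_comp (g := fun z : R => z ^+ 2)
    (is_derive1_powR (- (s / 2)) z2) d2.
  apply: (is_derive_eq_val (is_deriveM df dp)).
  rewrite /GRing.scale/= powRB; last by rewrite (gt_eqF z2) implybT.
  rewrite powRr1 ?ltW//; field.
  by [].
have [c _ e] := mean_value xy gd.
by apply/esym/eqP; rewrite -subr_eq0 -/(g x) -/(g y) e mul0r.
Qed.

Lemma homogeneous_ode_eq0 f (s a b x0 : R) : a < x0 < b ->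
  (forall z, a < z < b -> z != 0 /\ is_derive z 1 f (s * f z / z)) ->
  f x0 = 0 -> forall z, a < z < b -> f z = 0.
Proof.
move=> /andP[ax0 x0b] fd fx0 z /andP[az zb].
have p_neq0 t : a < t < b -> (t ^+ 2) `^ (- (s / 2)) != 0.
  by move=> /fd[t0 _]; rewrite gt_eqF// powR_gt0// exprn_even_gt0.
have [zx|/ltW xz] := leP z x0.
- have := @homogeneous_ode_invariant f s z x0 zx; rewrite fx0 mul0r => /(_ _)/eqP.
  rewrite mulf_eq0 (negbTE (p_neq0 _ _)) ?az// orbF => h; apply/eqP/h => t /andP[zt tx].
  by apply: fd; rewrite (lt_le_trans az)// (le_lt_trans tx).
- have := @homogeneous_ode_invariant f s x0 z xz; rewrite fx0 mul0r => /(_ _)/esym/eqP.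
  rewrite mulf_eq0 (negbTE (p_neq0 _ _)) ?az// orbF => h; apply/eqP/h => t /andP[xt tz].
  by apply: fd; rewrite (lt_le_trans ax0)// (le_lt_trans tz).
Qed.

(** Taylor coefficients at [x0] of the solution of [z f' = s f + B] with [f x0 = y0], where [b]
    expands [B (x0 + h)]: compare the coefficients of [h ^ n] in [(x0 + h) f' = s f + B]. *)
Fixpoint ode_coef (s x0 y0 : R) b (n : nat) : R :=
  if n is m.+1 then ((s - m%:R) * ode_coef s x0 y0 b m + b m) / (x0 * m.+1%:R)
  else y0.

Lemma ode_coef_bound (s x0 y0 K rho : R) b : x0 != 0 ->
  (forall n, `|b n| <= K * rho ^+ n) -> 0 < rho ->
  exists L rho', [/\ 0 < rho', rho <= rho' &
    forall n, `|ode_coef s x0 y0 b n| <= L * rho' ^+ n].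
Proof.
move=> x00 bK rho0; have nx0 : 0 < `|x0| by rewrite normr_gt0.
(* One step of the recurrence costs at most [(]|s| + 2) / [|x0|], since
   [|s - n| <= (|s| + 1) (n + 1)] and the source term adds one more multiple of [n + 1]. *)
pose rho' := Num.max rho ((`|s| + 2) / `|x0|).
have rr : rho <= rho' by rewrite le_max lexx.
have rho'0 : 0 < rho' by apply: lt_le_trans rr.
exists (Num.max `|y0| K), rho'; split=> //.
set L := Num.max _ _.
have L0 : 0 <= L by rewrite le_max normr_ge0.
have bL n : `|b n| <= L * rho' ^+ n.
  have K0 : 0 <= K by have := bK 0; rewrite expr0 mulr1; apply: le_trans.
  apply: (le_trans (bK n)); apply: ler_pM => //; first by rewrite exprn_ge0// ltW.
  - by rewrite le_max lexx orbT.
  - by apply: lerXn2r => //; rewrite nnegrE ltW.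
elim=> [|n IH] /=; first by rewrite expr0 mulr1 le_max lexx.
rewrite normrM normfV normrM normr_nat ler_pdivrMr ?mulr_gt0//.
apply: (le_trans (ler_normD _ _)); rewrite normrM.
have sn : `|s - n%:R| <= (`|s| + 1) * n.+1%:R.
  apply: (le_trans (ler_normB _ _)); rewrite normr_nat -natr1.
  have := normr_ge0 s; have : 0 <= n%:R :> R by []. 
  nra.
have h1 : `|s - n%:R| * `|ode_coef s x0 y0 b n| <= (`|s| + 1) * n.+1%:R * (L * rho' ^+ n).
  exact: ler_pM.
have h2 : `|b n| <= n.+1%:R * (L * rho' ^+ n).
  apply: (le_trans (bL n)); rewrite ler_peMl ?ler1n//.
  by rewrite mulr_ge0// exprn_ge0// ltW.
apply: (le_trans (lerD h1 h2)).
have h3 : `|s| + 2 <= rho' * `|x0| by rewrite -ler_pdivrMr// le_max lexx orbT.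
have h4 : 0 <= n.+1%:R * (L * rho' ^+ n).
  by rewrite !mulr_ge0// exprn_ge0// ltW.
rewrite exprS [leLHS](_ : _ = (`|s| + 2) * (n.+1%:R * (L * rho' ^+ n))); last by ring.
rewrite [leRHS](_ : _ = (rho' * `|x0|) * (n.+1%:R * (L * rho' ^+ n))); last by ring.
exact: ler_wpM2r.
Qed.

(** The formal solution with the initial value [f x0] converges near [x0]; its difference with [f]
    solves the homogeneous equation and vanishes at [x0], hence everywhere nearby. The bound
    [r <= |x0|] keeps the singular point [0] outside. *)
Lemma ode_analytic f B (s x0 r : R) b : 0 < r <= `|x0| ->
  (forall h, `|h| < r -> pseries b h @ \oo --> B (x0 + h)) ->
  (forall z, `|z - x0| < r -> is_derive z 1 f ((s * f z + B z) / z)) ->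
  real_analytic_at f x0.
Proof.
move=> /andP[r0 rx0] bB fd.
have x00 : x0 != 0 by rewrite -normr_gt0 (lt_le_trans r0).
have br : has_radius b r by move=> h /bB hb; apply/cvg_ex; exists (B (x0 + h)).
have r2 : 0 < r / 2 < r by lra.
have [K bK] := has_radius_geometric_bound br r2.
have r2' : 0 < (r / 2)^-1 by rewrite invr_gt0; lra.
have [L [rho [rho0 rrho uL]]] := ode_coef_bound s (f x0) x00 bK r2'.
set u := ode_coef _ _ _ _ in uL.
have ur : has_radius u rho^-1.
  move=> x xr; apply: (cvg_pseries_bound uL); first exact: ltW.
  by rewrite mulrC -ltr_pdivlMr// div1r.
(* Inside this smaller disc the expansion of [B] is valid and [z] does not vanish. *)
have rhor : rho^-1 < r.
  have : rho^-1 <= r / 2 by rewrite -[leRHS]invrK lef_pV2.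
  lra.
pose U (h : R) : R := limn (pseries u h).
have cU h : `|h| < rho^-1 -> pseries u h @ \oo --> U h by move=> /ur.
have U0 : U 0 = f x0.
  have h0 : `|0 : R| < rho^-1 by rewrite normr0 invr_gt0.
  by rewrite (cvg_pseries_inj (cU 0 h0) (@pseries_at0 _ u)).
have z_neq0 z : `|z - x0| < rho^-1 -> z != 0.
  move=> h; apply/eqP => z0; move: h; rewrite z0 sub0r normrN => h.
  by have := lt_trans h rhor; rewrite ltNge rx0.
have Ud (h : R) : `|h| < rho^-1 -> is_derive h 1 U ((s * U h + B (x0 + h)) / (x0 + h)).
  move=> hr; have := is_derive_pseries ur hr; set U' := limn _ => dU.
  apply: (is_derive_eq_val dU).
  have cU' : pseries (pseries_diffs u) h @ \oo --> U' by apply: (has_radius_diffs ur).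
  have xh0 : x0 + h != 0 by apply: z_neq0; rewrite addrC addKr.
  have lhs := cvg_pseriesD (cvg_pseriesZ (c := x0) cU') (cvg_pseries_mulnX cU').
  have rhs := cvg_pseriesD (cvg_pseriesZ (c := s) (cU h hr)) (bB h (lt_trans hr rhor)).
  apply: (mulIf xh0); rewrite divfK//.
  transitivity (x0 * U' + h * U'); first by ring.
  apply: (cvg_pseries_inj lhs).
  rewrite (_ : (fun n => _) = (fun n => s * u n + b n))//.
  apply/funext => n; rewrite /pseries_diffs.
  have -> : u n.+1 = ((s - n%:R) * u n + b n) / (x0 * n.+1%:R) by [].
  field.
  rewrite ?x00 ?andbT ?andTb nat1r pnatr_eq0//.
exists u, rho^-1; split; first by rewrite invr_gt0.
move=> x xx0; rewrite (_ : f x = U (x - x0)); first exact: cU.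
pose D z := f z - U (z - x0).
suff : D x = 0 by move/eqP; rewrite subr_eq0 => /eqP.
apply: (@homogeneous_ode_eq0 D s (x0 - rho^-1) (x0 + rho^-1) x0).
- by rewrite ltrBlDr ltrDl invr_gt0 rho0.
- move=> z; rewrite -ltr_distlC distrC => zx0; split; first exact: z_neq0.
  have dz : is_derive z 1 (fun z : R => z - x0) 1.
    by apply: (is_derive_eq_val (is_deriveB (is_derive_id z 1) (is_derive_cst x0 z 1)));
      rewrite subr0.
  have dU := is_derive1_comp (g := fun z : R => z - x0) (Ud _ zx0) dz.
  have df := fd z (lt_trans zx0 rhor).
  apply: (is_derive_eq_val (is_deriveB df dU)).
  by rewrite (addrC x0) subrK /D; ring.
- by rewrite /D subrr U0 subrr.
- by rewrite -ltr_distlC distrC.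
Qed.

(** Convergence at positive points already gives the whole disc, where the sum is continuous; its
    limit at [0] from the right is both [u 0] and [0]. *)
Lemma pseries_coef0_eq0 u (r : R) : 0 < r ->
  (forall h, 0 < h < r -> pseries u h @ \oo --> (0 : R)) -> u 0%N = 0.
Proof.
move=> r0 u0.
have ur : has_radius u r.
  move=> x xr.
  have [y /andP[xy yr]] : exists y, `|x| < y < r by exists ((`|x| + r) / 2); lra.
  have y0 : 0 < y by apply: le_lt_trans xy.
  apply: (@is_cvg_pseries_inside _ _ y); last by rewrite (gtr0_norm y0).
  by apply/cvg_ex; exists 0; apply: u0; rewrite y0.
have nr0 : `|0 : R| < r by rewrite normr0.
have [dU _] := is_derive_pseries ur nr0.
have cU : {for 0, continuous (fun x => limn (pseries u x))}.
  exact/differentiable_continuous/derivable1_diffP.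
have e0 : limn (pseries u 0) = u 0%N by apply: cvg_lim => //; exact: pseries_at0.
have c1 : limn (pseries u x) @[x --> (0:R)^'+] --> u 0%N.
  by rewrite -e0; apply: cvg_at_right_filter.
have c2 : limn (pseries u x) @[x --> (0:R)^'+] --> (0 : R).
  apply: (@cvg_trans _ ((0 : R) @[x --> (0:R)^'+])); last exact: cvg_cst.
  apply: near_eq_cvg; near=> x; apply/esym/cvg_lim => //; apply: u0.
  by apply/andP; split; near: x; [exact: nbhs_right_gt|exact: nbhs_right_lt].
exact: (cvg_unique _ c1 c2).
Unshelve. all: by end_near. Qed.

(** Once the constant coefficient is known to vanish, division by [h] shifts the series and the
    induction continues. Vanishing on the right of [0] is all that the identity theorem will
    supply. *)
Lemma pseries_coef_eq0 u (r : R) : 0 < r ->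
  (forall h, 0 < h < r -> pseries u h @ \oo --> (0 : R)) -> forall n, u n = 0.
Proof.
move=> r0 u0 n; elim: n u u0 => [|n IH] u u0; first exact: (pseries_coef0_eq0 r0).
apply: (IH (u \o S)) => h hr; have /andP[h0 _] := hr.
rewrite (_ : pseries _ _ = fun n => h^-1 * pseries u h n.+1).
  rewrite -[0 in X in _ --> X](mulr0 h^-1).
  by apply: cvgMl_tmp; rewrite (cvg_shiftS (pseries u h)); exact: u0.
apply/funext => m; rewrite /pseries /series/= big_nat_recl//=.
rewrite (pseries_coef0_eq0 r0 u0) mul0r add0r mulr_sumr.
by apply: eq_bigr => i _; rewrite exprS mulrCA mulKf// gt_eqF.
Qed.

Lemma analytic_right_eq_near F G (x0 e : R) : 0 < e ->
  real_analytic_at F x0 -> real_analytic_at G x0 ->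
  (forall x, x0 < x < x0 + e -> F x = G x) ->
  exists2 r, 0 < r & forall x, `|x - x0| < r -> F x = G x.
Proof.
move=> e0 [u [r [r0 uF]]] [v [r' [r'0 vG]]] FG.
pose r1 := Num.min r (Num.min r' e).
have r10 : 0 < r1 by rewrite !lt_min r0 r'0.
have r1r : r1 <= r by rewrite ge_min lexx.
have r1r' : r1 <= r' by rewrite !ge_min lexx orbT.
have r1e : r1 <= e by rewrite !ge_min lexx !orbT.
have uv n : u n = v n.
  apply/eqP; rewrite -subr_eq0; apply/eqP.
  rewrite -mulN1r.
  apply: (@pseries_coef_eq0 (fun n => u n + -1 * v n) r1 r10 _ n) => h /andP[h0 hr].
  have hn : `|(x0 + h) - x0| < r1 by rewrite addrC addKr gtr0_norm.
  have := cvg_pseriesD (uF _ (lt_le_trans hn r1r))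
            (cvg_pseriesZ (c := -1) (vG _ (lt_le_trans hn r1r'))).
  rewrite FG; last by rewrite ltrDl h0 ltrD2l (lt_le_trans hr).
  by rewrite mulN1r subrr addrC addKr.
exists r1 => // x xr.
have := uF _ (lt_le_trans xr r1r); rewrite (_ : u = v); last exact/funext.
by move/cvg_pseries_inj; apply; apply: vG; exact: lt_le_trans xr r1r'.
Qed.

(** Agreement is pushed leftwards: if it holds to the right of a point, the two expansions there
    coincide, so it extends past that point. *)
Lemma analytic_identity F G (b c : R) : b < c ->
  (forall x, x < c -> real_analytic_at F x) ->
  (forall x, x < c -> real_analytic_at G x) ->
  (forall x, b < x < c -> F x = G x) -> forall x, x < c -> F x = G x.
Proof.
move=> bc aF aG FG x0 x0c.
have [bx0|x0b] := ltP b x0; first by apply: FG; rewrite bx0.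
(* The cut at [x0 - 1] makes the set bounded below; if its infimum were at least [x0], an element
   below the infimum could be produced. *)
pose A : set R := [set y | x0 - 1 <= y < c /\ forall x, y < x < c -> F x = G x].
have Ab : A b by split=> //; rewrite bc andbT (le_trans _ x0b)// lerBlDr lerDl.
have lA : has_lbound A by exists (x0 - 1) => y [/andP[]].
have hA : has_inf A by split=> //; exists b.
pose m := inf A.
have x0m : x0 - 1 <= m by apply: lb_le_inf => [|y [/andP[]]//]; exists b.
have mb : m <= b by exact: ge_inf.
have mFG x : m < x < c -> F x = G x.
  move=> /andP[mx xc].
  have [y [_ yFG] yx] := @inf_lt _ A x (ex_intro _ b Ab) mx.
  by apply: yFG; rewrite yx.
have [x0x|] := ltP m x0; first by apply: mFG; rewrite x0x.
move=> x0m'; have mc : m < c by apply: le_lt_trans bc.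
have [| |r r0 near_m] := @analytic_right_eq_near F G m (c - m) _ (aF _ mc) (aG _ mc).
- by rewrite subr_gt0.
- by move=> x; rewrite addrCA subrr addr0; exact: mFG.
(* Left of [m] by at most [r / 2], so still in the disc of agreement, yet not below the cut. *)
pose y := Num.max (m - r / 2) (x0 - 1).
have ym : y < m by rewrite gt_max ltrBlDr ltrDl divr_gt0//= (lt_le_trans _ x0m')// ltrBlDr ltrDl.
suff : A y by move=> /(ge_inf lA); rewrite leNgt ym.
split; first by rewrite le_max lexx orbT/= (lt_trans ym).
move=> x /andP[yx xc]; have [mx|xm] := ltP m x; first by apply: mFG; rewrite mx.
apply: near_m; rewrite distrC ger0_norm ?subr_ge0//.
rewrite ltrBlDl -ltrBlDr (le_lt_trans _ yx)// le_max; apply/orP; left.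
by rewrite lerD2l lerN2 ler_piMr ?invf_le1 ?ler1n// ltW.
Qed.

End OneVariable.

(** * The hypergeometric function on the negative axis *)

Lemma real_analytic_at_near (R : realType) (f g : R -> R) (x0 e : R) : 0 < e ->
  (forall x, `|x - x0| < e -> f x = g x) ->
  real_analytic_at f x0 -> real_analytic_at g x0.
Proof.
move=> e0 fg [u [r [r0 uf]]]; exists u, (Num.min r e); split.
  by rewrite lt_min r0.
by move=> x; rewrite lt_min => /andP[xr xe]; rewrite -fg//; exact: uf.
Qed.

(* Since [s < 1], the solutions [c * `|z| `^ s] with [c != 0] are not differentiable at [0]. *)
Lemma homogeneous_ode_derivable_eq0 (R : realType) (E : R -> R) (s l r : R) : s < 1 ->
  (forall z, - r < z < 0 -> is_derive z 1 E (s * E z / z)) ->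
  is_derive (0 : R) 1 E l -> E 0 = 0 -> forall z, - r < z < 0 -> E z = 0.
Proof.
move=> s1 Eode [dE _] E0 z /andP[rz z0].
have Nz0 : 0 < - z by rewrite oppr_gt0.
have p0 : (z ^+ 2) `^ (- (s / 2)) != 0.
  by rewrite gt_eqF// powR_gt0// exprn_even_gt0//= lt_eqF.
apply/eqP; rewrite -(mulIr_eq0 _ (mulIf p0)); apply/eqP.
have inv x : 0 < x < - z ->
    E z * (z ^+ 2) `^ (- (s / 2)) = (x^-1 * E (- x)) * x `^ (1 - s).
  move=> /andP[x0 xz].
  rewrite (@homogeneous_ode_invariant _ E s z (- x)).
  - rewrite sqrrN -[x ^+ 2]powR_mulrn ?ltW// -powRrM (_ : 2 * _ = - s); last by field.
    rewrite powRB; last by rewrite gt_eqF// implybT.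
    by rewrite powRr1 ?ltW// powRN; field; rewrite !gt_eqF// powR_gt0.
  - by rewrite lerNr ltW.
  - move=> t /andP[zt tx]; have t0 : t < 0 by rewrite (le_lt_trans tx)// oppr_lt0.
    by split; [rewrite lt_eqF|apply: Eode; rewrite (lt_le_trans rz)].
have q : (x^-1 * E (- x)) * x `^ (1 - s) @[x --> 0^'+] --> - 'D_1 E 0 * 0.
  apply: cvgM; last by apply: powR_cvg0; rewrite subr_gt0.
  have : (h^-1 *: (E (h + 0) - E 0)) @[h --> (0:R)^'-] --> 'D_1 E 0.
    have : h^-1 *: (E (h *: 1 + 0) - E 0) @[h --> (0:R)^'] --> 'D_1 E 0 by exact: dE.
    move=> /cvg_dnbhs_at_left; apply: cvg_trans; apply: near_eq_cvg; near=> h.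
    by rewrite /GRing.scale/= mulr1.
  move=> /cvg_at_leftNP; rewrite oppr0 => /cvgN; apply: cvg_trans; apply: near_eq_cvg.
  near=> h. by rewrite !fctE /= E0 subr0 addr0 /GRing.scale/= invrN mulNr opprK.
rewrite mulr0 in q.
suff q' : (x^-1 * E (- x)) * x `^ (1 - s) @[x --> 0^'+] --> E z * (z ^+ 2) `^ (- (s / 2)).
  exact: (cvg_unique _ q' q).
apply: (@cvg_trans _ ((E z * (z ^+ 2) `^ (- (s / 2))) @[_ --> (0:R)^'+])); last exact: cvg_cst.
apply: near_eq_cvg; near=> x; apply: inv.
by apply/andP; split; near: x; [exact: nbhs_right_gt|exact: nbhs_right_lt].
Unshelve. all: by end_near. Qed.

Section Pochhammer.
Context {R : realType}.
Implicit Types (a b t : R) (n : nat).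

Lemma pochhammer0 a : pochhammer a 0 = 1.
Proof. by rewrite /pochhammer big_ord0. Qed.

Lemma pochhammerS a n : pochhammer a n.+1 = pochhammer a n * (a + n%:R).
Proof. by rewrite /pochhammer big_ord_recr. Qed.

Lemma pochhammerSl a n : pochhammer a n.+1 = a * pochhammer (a + 1) n.
Proof.
rewrite /pochhammer big_ord_recl addr0; congr (_ * _).
by apply: eq_bigr => i _; rewrite lift0 -addrA nat1r.
Qed.

Lemma pochhammer_gt0 a n : 0 < a -> 0 < pochhammer a n.
Proof. by move=> a0; apply: prodr_gt0 => i _; rewrite ltr_wpDr. Qed.

(** Serves the binomial coefficients with [t = 0] and the Pfaff coefficients with [t = s]; beyond
    [a / (rho - 1)] one has [a + n <= rho * n <= rho * (n + 1 - t)]. *)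
Lemma has_radius_pochhammer_ratio (u : R^nat) a t : 0 <= a -> t < 1 ->
  (forall n, (n.+1%:R - t) * u n.+1 = (a + n%:R) * u n) -> has_radius u 1.
Proof.
move=> a0 t1 uS; apply: has_radius_ratio => // rho; rewrite invr1 => rho1.
exists (Num.truncn (a / (rho - 1))).+1 => n Nn.
have an : a < n%:R * (rho - 1).
  rewrite -ltr_pdivrMr ?subr_gt0//; apply: (lt_le_trans (truncnS_gt _)).
  by rewrite ler_nat.
have n1t : 0 < n.+1%:R - t by rewrite subr_gt0 (lt_le_trans t1)// ler1n.
rewrite -(ler_pM2l n1t) -[X in X * `|u n.+1|]gtr0_norm// -normrM uS normrM.
rewrite mulrA ler_wpM2r// ger0_norm ?addr_ge0//.
rewrite -natr1; nra.
Qed.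
End Pochhammer.

(** * The binomial series of [(1 - z) ^ (- M)] *)

Section NegativeBinomial.
Context {R : realType}.
Variable M : nat.

Definition negbin_coef (n : nat) : R := pochhammer M%:R n / n`!%:R.

Lemma negbin_coefS n : n.+1%:R * negbin_coef n.+1 = (M%:R + n%:R) * negbin_coef n.
Proof.
rewrite /negbin_coef pochhammerS factS natrM; field.
by rewrite pnatr_eq0 gtn_eqF ?fact_gt0//= addrC natr1 pnatr_eq0.
Qed.

Lemma has_radius_negbin : has_radius negbin_coef 1.
Proof.
apply: (@has_radius_pochhammer_ratio _ _ M%:R 0) => // n.
by rewrite subr0 negbin_coefS.
Qed.

Lemma is_derive_onemXN (z : R) : z < 1 ->
  is_derive z 1 (fun z : R => (1 - z) ^- M) (M%:R * (1 - z) ^- M / (1 - z)).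
Proof.
move=> z1; have z0 : 1 - z != 0 by rewrite gt_eqF// subr_gt0.
have d1 : is_derive z 1 (fun z : R => 1 - z) (-1).
  by apply: (is_derive_eq_val (is_deriveB (is_derive_cst (1 : R) z 1) (is_derive_id z 1)));
    rewrite sub0r.
have dX := is_deriveX M d1; rewrite exprfctE in dX.
have dV := is_deriveV (f := fun z : R => (1 - z) ^+ M) (expf_neq0 M z0) dX.
apply: (is_derive_eq_val dV).
rewrite /GRing.scale/=.
case: M {dX dV} => [|m]; first by rewrite !mul0r mulr0.
rewrite /= (exprS _ m); set X := _ ^+ m; have X0 : X != 0 by rewrite expf_neq0.
field.
by rewrite z0 X0.
Qed.

(** Sum and closed form both satisfy [(1 - z) D' = M D] with value [1] at [0], so their quotient is
    constant. *)
Lemma cvg_negbin (y : R) : `|y| < 1 -> pseries negbin_coef y @ \oo --> (1 - y) ^- M.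
Proof.
move=> y1; pose D (z : R) : R := limn (pseries negbin_coef z).
have cD z : `|z| < 1 -> pseries negbin_coef z @ \oo --> D z by move=> /has_radius_negbin.
suff <- : D y = (1 - y) ^- M by exact: cD.
have dD (z : R) : `|z| < 1 -> is_derive z 1 D (M%:R * D z / (1 - z)).
  move=> z1; have z0 : 1 - z != 0.
    by rewrite gt_eqF// subr_gt0 (le_lt_trans (ler_norm _)).
  have := is_derive_pseries has_radius_negbin z1; set D' := limn _ => dD.
  apply: (is_derive_eq_val dD).
  have cD' : pseries (pseries_diffs negbin_coef) z @ \oo --> D'.
    exact: (has_radius_diffs has_radius_negbin).
  apply: (mulIf z0); rewrite divfK//.
  transitivity (D' + -1 * (z * D')); first by ring.
  apply: (cvg_pseries_inj (cvg_pseriesD cD' (cvg_pseriesZ (c := -1) (cvg_pseries_mulnX cD')))).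
  rewrite (_ : (fun n => _) = (fun n => M%:R * negbin_coef n)).
    exact: (cvg_pseriesZ (cD _ z1)).
  by apply/funext => n; rewrite /pseries_diffs negbin_coefS; ring.
pose q (z : R) : R := D z / (1 - z) ^- M.
have dq (z : R) : `|z| < 1 -> is_derive z 1 q ((cst 0 : R -> R) z).
  move=> z1; have z1' : z < 1 by rewrite (le_lt_trans (ler_norm _)).
  have z0 : 1 - z != 0 by rewrite gt_eqF// subr_gt0.
  have B0 : (1 - z) ^- M != 0 by rewrite invr_eq0 expf_neq0.
  have dV := is_deriveV (f := fun z : R => (1 - z) ^- M) B0 (is_derive_onemXN z1').
  apply: (is_derive_eq_val (is_deriveM (dD z z1) dV)).
  by rewrite /GRing.scale/=; field; rewrite z0 expf_neq0.
have q0 : q 0 = 1.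
  rewrite /q subr0 expr1n invr1 divr1; apply: cvg_lim => //.
  rewrite (_ : 1 = negbin_coef 0); first exact: pseries_at0.
  by rewrite /negbin_coef pochhammer0 fact0 divr1.
have B0 : (1 - y) ^- M != 0.
  by rewrite invr_eq0 expf_neq0// gt_eqF// subr_gt0 (le_lt_trans (ler_norm _)).
have qy : q y = 1.
  rewrite -q0; have := y1; rewrite ltr_norml => /andP[y1' y1''].
  have [y0|/ltW y0] := leP y 0.
    have [|c _ e] := @mean_value _ q (cst 0) y 0 y0.
      move=> t /andP[yt t0]; apply: dq; rewrite ltr_norml (lt_le_trans y1')//=.
      exact: (le_lt_trans t0).
    by apply/esym/eqP; rewrite -subr_eq0 e mul0r.
  have [|c _ e] := @mean_value _ q (cst 0) 0 y y0.
    move=> t /andP[t0 ty]; apply: dq; rewrite ltr_norml (le_lt_trans ty)// andbT.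
    by apply: lt_le_trans t0; rewrite oppr_lt0.
  by apply/eqP; rewrite -subr_eq0 e mul0r.
by rewrite -[LHS](divfK B0) -/(q y) qy mul1r.
Qed.

(** Rescaling: [1 - (x0 + h) = (1 - x0) (1 - h / (1 - x0))]. This expands the source term of the
    equation at any point below [1]. *)
Lemma cvg_negbin_center (x0 h : R) : `|h| < 1 - x0 ->
  pseries (fun n => (1 - x0) ^- M * (negbin_coef n / (1 - x0) ^+ n)) h @ \oo -->
    (1 - (x0 + h)) ^- M.
Proof.
move=> hx; have x1 : 0 < 1 - x0 by apply: le_lt_trans hx.
have hx1 : `|h / (1 - x0)| < 1.
  by rewrite normrM normfV (gtr0_norm x1) ltr_pdivrMr// mul1r.
rewrite (_ : pseries _ h = fun n =>
  (1 - x0) ^- M * pseries negbin_coef (h / (1 - x0)) n); last first.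
  apply/funext => n; rewrite /pseries /series/= mulr_sumr; apply: eq_bigr => i _.
  by rewrite expr_div_n; ring.
have -> : (1 - (x0 + h)) ^- M = (1 - x0) ^- M * (1 - h / (1 - x0)) ^- M.
  by rewrite -invfM -exprMn mulrBr mulr1 mulrCA divff ?gt_eqF// mulr1 opprD addrA.
exact: (cvgMl_tmp (cvg_negbin hx1)).
Qed.

End NegativeBinomial.

(** * The series at the origin and its Pfaff transform *)

Section Hypergeometric.
Context {R : realType}.
Variables (s : R) (M : nat).
Hypotheses (s_gt0 : 0 < s) (s_lt1 : s < 1).

Let a := hyp2F1_coef (- s) M%:R (1 - s).
Let d := @negbin_coef R M.

Lemma natB_neq0 (n : nat) : n%:R - s != 0.
Proof.
case: n => [|n]; first by rewrite sub0r oppr_eq0 gt_eqF.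
by rewrite gt_eqF// subr_gt0 (lt_le_trans s_lt1)// ler1n.
Qed.

(** The two Pochhammer symbols with bases [- s] and [1 - s] telescope; summed over [n], this is the
    first-order equation. *)
Lemma hyp2F1_coefE n : (n%:R - s) * a n = - s * d n.
Proof.
have p0 : pochhammer (1 - s) n != 0 by rewrite gt_eqF// pochhammer_gt0// subr_gt0.
have e : (n%:R - s) * pochhammer (- s) n = - s * pochhammer (1 - s) n.
  by rewrite (addrC n%:R) mulrC -pochhammerS pochhammerSl (addrC (- s)).
have f0 : n`!%:R != 0 :> R by rewrite pnatr_eq0 gtn_eqF ?fact_gt0.
rewrite /a /d /hyp2F1_coef /negbin_coef.
transitivity ((n%:R - s) * pochhammer (- s) n * pochhammer M%:R n
   / (pochhammer (1 - s) n * n`!%:R)); first by ring.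
by rewrite e; field; rewrite p0 f0.
Qed.

Lemma hyp2F1_coef0 : a 0%N = 1.
Proof. by rewrite /a /hyp2F1_coef !pochhammer0 fact0 !mul1r invr1. Qed.

Lemma has_radius_hyp2F1 : has_radius a 1.
Proof.
(* A lower bound for the distance from [s] to the naturals, so the coefficients are at most [s / m]
   times the binomial ones. *)
move=> x x1; pose m := Num.min s (1 - s).
have m0 : 0 < m by rewrite lt_min s_gt0 subr_gt0.
have ma n : m <= `|n%:R - s|.
  case: n => [|n]; first by rewrite sub0r normrN gtr0_norm// ge_min lexx.
  rewrite gtr0_norm ?subr_gt0 ?(lt_le_trans s_lt1) ?ler1n// ge_min.
  by apply/orP; right; rewrite lerD2r ler1n.
have [y /andP[xy y1]] : exists y, `|x| < y < 1 by exists ((`|x| + 1) / 2); lra.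
have y0 : 0 < y by apply: le_lt_trans xy.
have y01 : 0 < y < 1 by rewrite y0.
have [K dK] := has_radius_geometric_bound (@has_radius_negbin R M) y01.
apply: (@cvg_pseries_bound _ _ (s / m * K) y^-1); last 2 first.
- by rewrite invr_ge0 ltW.
- by rewrite mulrC ltr_pdivrMr// mul1r.
move=> n; rewrite -mulrA (le_trans _ (ler_wpM2l _ (dK n)))//; last first.
  by rewrite divr_ge0// ltW.
have e : `|n%:R - s| * `|a n| = s * `|d n|.
  by rewrite -normrM hyp2F1_coefE normrM normrN (gtr0_norm s_gt0).
by rewrite mulrAC ler_pdivlMr// -/d -e mulrC ler_wpM2r.
Qed.

Definition hyp2F1_series (z : R) : R := limn (pseries a z).

Lemma cvg_hyp2F1_series z : `|z| < 1 -> pseries a z @ \oo --> hyp2F1_series z.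
Proof. by move=> /has_radius_hyp2F1. Qed.

Lemma is_derive_hyp2F1_series0 : exists l, is_derive (0 : R) 1 hyp2F1_series l.
Proof. by eexists; apply: (is_derive_pseries has_radius_hyp2F1); rewrite normr0. Qed.

Lemma is_derive_hyp2F1_series (z : R) : `|z| < 1 -> z != 0 ->
  is_derive z 1 hyp2F1_series ((s * hyp2F1_series z + - s * (1 - z) ^- M) / z).
Proof.
move=> z1 z0; have := is_derive_pseries has_radius_hyp2F1 z1; set f' := limn _ => df.
apply: (is_derive_eq_val df).
have cf' : pseries (pseries_diffs a) z @ \oo --> f' by apply: (has_radius_diffs has_radius_hyp2F1).
apply: (mulIf z0); rewrite divfK// mulrC.
have lhs := cvg_pseries_mulnX cf'.
have rhs := cvg_pseriesD (cvg_pseriesZ (c := s) (cvg_hyp2F1_series z1))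
  (cvg_pseriesZ (c := - s) (@cvg_negbin R M z z1)).
apply: (cvg_pseries_inj lhs); rewrite (_ : (fun n => _) = (fun n => s * a n + - s * d n))//.
by apply/funext => n; rewrite -hyp2F1_coefE; ring.
Qed.

(** Coefficients of [2F1(1, M; 1 - s; w)]: the symbol [(1)_n] cancels [n!]. *)
Definition pfaff_coef (n : nat) : R := pochhammer M%:R n / pochhammer (1 - s) n.

Lemma pfaff_coefS n : (n.+1%:R - s) * pfaff_coef n.+1 = (M%:R + n%:R) * pfaff_coef n.
Proof.
have p0 : pochhammer (1 - s) n != 0 by rewrite gt_eqF// pochhammer_gt0// subr_gt0.
have n0 := natB_neq0 n.+1.
have e : 1 - s + n%:R = n.+1%:R - s by rewrite addrAC nat1r.
rewrite /pfaff_coef !pochhammerS e; field.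
by rewrite nat1r n0 p0.
Qed.

Lemma has_radius_pfaff : has_radius pfaff_coef 1.
Proof. by apply: (has_radius_pochhammer_ratio (ler0n _ M) s_lt1) => n; exact: pfaff_coefS. Qed.

Definition pfaff_series (w : R) : R := limn (pseries pfaff_coef w).

Lemma cvg_pfaff_series w : `|w| < 1 -> pseries pfaff_coef w @ \oo --> pfaff_series w.
Proof. by move=> /has_radius_pfaff. Qed.

(** Summing the recurrence [pfaff_coefS] loses the constant term, which returns as [- s]. The
    equation is left multiplied out so that it also covers [w = 0]. *)
Lemma is_derive_pfaff_series (w : R) : `|w| < 1 -> exists2 k',
  is_derive w 1 pfaff_series k' &
  w * (1 - w) * k' = (s + M%:R * w) * pfaff_series w - s.
Proof.
move=> w1; have := is_derive_pseries has_radius_pfaff w1; set k' := limn _ => dk.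
exists k' => //.
have ck' : pseries (pseries_diffs pfaff_coef) w @ \oo --> k'.
  exact: (has_radius_diffs has_radius_pfaff).
have ck := cvg_pfaff_series w1.
have lhs := cvg_pseriesD (cvg_pseries_mulnX ck') (cvg_pseriesZ (c := - s) ck).
have rhs := cvg_pseriesD (cvg_pseriesZ (c := M%:R) ck) (cvg_pseries_mulnX ck').
suff e : w * k' + - s * pfaff_series w = - s + w * (M%:R * pfaff_series w + w * k').
  by apply: (@addrI _ (- s * pfaff_series w + w ^+ 2 * k')); move: e; lra.
pose v n := n%:R * pfaff_coef n + - s * pfaff_coef n.
have v0 : v 0%N = - s by rewrite /v mul0r add0r /pfaff_coef !pochhammer0 divr1 mulr1.
have vS : v \o S = (fun n => M%:R * pfaff_coef n + n%:R * pfaff_coef n).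
  by apply/funext => n /=; rewrite -[RHS]mulrDl -pfaff_coefS /v; ring.
rewrite -vS in rhs; have := cvg_pseries_recl rhs; rewrite v0.
exact: cvg_pseries_inj lhs.
Qed.

(* Pfaff's transformation of [hyp2F1 (- s) M (1 - s) z]. *)
Definition pfaff (z : R) : R := (1 - z) ^- M * pfaff_series (z / (z - 1)).

(** For [z < 1] the point [z / (z - 1)] lies in the unit disc exactly when [z < 1/2]. Reaching
    [z = 0] matters: differentiability there is what selects the regular solution. *)
Lemma is_derive_pfaff_aux (z : R) : z < 2^-1 -> exists2 l, is_derive z 1 pfaff l &
  z * l = s * pfaff z + - s * (1 - z) ^- M.
Proof.
move=> z12; have z1 : z < 1 by lra.
have z0 : 1 - z != 0 by rewrite gt_eqF// subr_gt0.
have z0' : z - 1 != 0 by rewrite lt_eqF// subr_lt0.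
have w1 : `|z / (z - 1)| < 1.
  rewrite normrM normfV ltr_pdivrMr ?normr_gt0// mul1r.
  rewrite (ltr0_norm (x := z - 1)) ?subr_lt0//.
  by rewrite ltr_norml; apply/andP; split; lra.
have [k' dk ek] := is_derive_pfaff_series w1.
have d1 : is_derive z 1 (fun z : R => z - 1) 1.
  by apply: (is_derive_eq_val (is_deriveB (is_derive_id z 1) (is_derive_cst (1 : R) z 1)));
    rewrite subr0.
have dw := is_deriveM (is_derive_id z 1) (is_deriveV (f := fun z : R => z - 1) z0' d1).
have dkw := is_derive1_comp (g := fun z : R => z / (z - 1)) dk dw.
have dg := is_deriveM (@is_derive_onemXN R M z z1) dkw.
eexists; first exact: dg.
rewrite /GRing.scale/= /pfaff.
set k := pfaff_series _ in ek *.
set w := z / (z - 1) in ek *.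
have X0 : (1 - z) ^+ M != 0 by rewrite expf_neq0.
have ek' : z * k' * (z - 1) ^- 2 = - ((s + M%:R * w) * k - s).
  by rewrite -ek /w; field; rewrite z0'.
transitivity ((1 - z) ^- M * (- (z * k' * (z - 1) ^- 2) + M%:R * (z / (1 - z)) * k)).
  rewrite /w; field; rewrite X0 z0 z0'//.
by rewrite ek' /w; field; rewrite X0 z0 z0'.
Qed.

End Hypergeometric.

(** * Gluing the two representations; identification of [hyp2F1] *)

Section HypergeometricContinuation.
Context {R : realType}.
Variables (s : R) (M : nat).
Hypotheses (s_gt0 : 0 < s) (s_lt1 : s < 1).

Lemma is_derive_pfaff (z : R) : z < 0 ->
  is_derive z 1 (pfaff s M) ((s * pfaff s M z + - s * (1 - z) ^- M) / z).
Proof.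
move=> z0; have [|l dl <-] := @is_derive_pfaff_aux R s M s_gt0 s_lt1 z.
  by rewrite (lt_trans z0)// invr_gt0.
by rewrite mulrAC divff ?lt_eqF// mul1r.
Qed.

Lemma hyp2F1_series0 : hyp2F1_series s M 0 = 1.
Proof.
rewrite -(hyp2F1_coef0 s M); apply: cvg_lim => //; exact: pseries_at0.
Qed.

Lemma pfaff0 : pfaff s M 0 = 1.
Proof.
rewrite /pfaff subr0 expr1n invr1 mul1r mul0r; apply: cvg_lim => //.
rewrite (_ : 1 = pfaff_coef s M 0); first exact: pseries_at0.
by rewrite /pfaff_coef !pochhammer0 divr1.
Qed.

(** The difference solves the homogeneous equation left of [0], is differentiable at [0] and
    vanishes there, which excludes nonzero multiples of [|z| ^ s]. *)
Lemma hyp2F1_series_pfaff z : -1 < z < 0 -> hyp2F1_series s M z = pfaff s M z.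
Proof.
move=> z10; apply/eqP; rewrite -subr_eq0; apply/eqP.
have [l dl] := @is_derive_hyp2F1_series0 R s M s_gt0 s_lt1.
have [|l' dl' _] := @is_derive_pfaff_aux R s M s_gt0 s_lt1 0; first by rewrite invr_gt0.
apply: (@homogeneous_ode_derivable_eq0 R (hyp2F1_series s M \- pfaff s M) s (l - l') 1) => //.
- move=> t /andP[t1 t0]; have t1' : `|t| < 1.
    by rewrite ltr_norml t1/= (lt_trans t0).
  have t0' : t != 0 by rewrite lt_eqF.
  have dF := is_derive_hyp2F1_series M s_gt0 s_lt1 t1' t0'.
  apply: (is_derive_eq_val (is_deriveB dF (is_derive_pfaff t0))).
  rewrite /=; field.
  by rewrite t0' expf_neq0// gt_eqF// subr_gt0 (lt_trans t0).
- by rewrite /= hyp2F1_series0 pfaff0 subrr.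
Qed.

Definition hyp2F1_continued (z : R) : R :=
  if z < 0 then pfaff s M z else hyp2F1_series s M z.

Lemma onemXN_cvg (x0 h : R) : `|h| < 1 - x0 ->
  pseries (fun n => - s * ((1 - x0) ^- M * (negbin_coef M n / (1 - x0) ^+ n))) h @ \oo -->
    - s * (1 - (x0 + h)) ^- M.
Proof. by move=> /(@cvg_negbin_center R M)/(cvg_pseriesZ (c := - s)). Qed.

(** Away from [0] the equation is regular on a disc avoiding [0], so [ode_analytic] applies; at [0]
    the defining series represents both branches. *)
Lemma hyp2F1_continued_analytic x0 : x0 < 1 -> real_analytic_at hyp2F1_continued x0.
Proof.
move=> x01; have [xlt0|xgt0|x00] := ltgtP x0 0.
- have nx0 : `|x0| = - x0 by rewrite ltr0_norm.
  apply: (@real_analytic_at_near _ (pfaff s M) _ _ (- x0)); first by rewrite oppr_gt0.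
    move=> x; rewrite ltr_norml ltrBlDr addNr => /andP[_ x0'].
    by rewrite /hyp2F1_continued x0'.
  apply: (@ode_analytic _ _ (fun z => - s * (1 - z) ^- M) s x0 (- x0)).
  + by rewrite nx0 oppr_gt0 xlt0 lexx.
  + by move=> h hx; apply: onemXN_cvg; rewrite (lt_trans hx)// ltrDr.
  + move=> z; rewrite ltr_norml => /andP[_ zx]; apply: is_derive_pfaff.
    by move: zx; rewrite ltrBlDr addNr.
- pose r := Num.min x0 (1 - x0).
  have r0 : 0 < r by rewrite lt_min xgt0 subr_gt0.
  have rx : r <= x0 by rewrite ge_min lexx.
  have rx1 : r <= 1 - x0 by rewrite ge_min lexx orbT.
  have pos z : `|z - x0| < r -> 0 < z < 1.
    by rewrite ltr_norml => /andP[h1 h2]; apply/andP; split; lra.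
  apply: (@real_analytic_at_near _ (hyp2F1_series s M) _ _ r r0).
    by move=> x /pos/andP[x0' _]; rewrite /hyp2F1_continued ltNge ltW.
  apply: (@ode_analytic _ _ (fun z => - s * (1 - z) ^- M) s x0 r).
  + by rewrite gtr0_norm// r0.
  + by move=> h hx; apply: onemXN_cvg; rewrite (lt_le_trans hx).
  + move=> z /pos/andP[z0 z1]; apply: is_derive_hyp2F1_series => //.
      by rewrite gtr0_norm.
    by rewrite gt_eqF.
- exists (hyp2F1_coef (- s) M%:R (1 - s)), 1; split=> // x; rewrite x00 subr0 => x1.
  rewrite /hyp2F1_continued; case: ifPn => [xlt0|_]; last exact: cvg_hyp2F1_series.
  rewrite -hyp2F1_series_pfaff; first exact: cvg_hyp2F1_series.
  by move: x1; rewrite ltr_norml xlt0 => /andP[->].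
Qed.

Lemma hyp2F1_continued_spec : is_hyp2F1 (- s) M%:R (1 - s) hyp2F1_continued.
Proof.
split=> [z z1|]; last exact: hyp2F1_continued_analytic.
rewrite /hyp2F1_continued; case: ifPn => [zlt0|_]; last exact: cvg_hyp2F1_series.
rewrite -hyp2F1_series_pfaff; first exact: cvg_hyp2F1_series.
by move: z1; rewrite ltr_norml zlt0 => /andP[->].
Qed.

(** The continuation witnesses that the specification is satisfiable, so the chosen function meets
    it; both have the same series on the unit disc, and the identity theorem does the rest. *)
Lemma hyp2F1_pfaff z : z < 0 -> hyp2F1 (- s) M%:R (1 - s) z = pfaff s M z.
Proof.
move=> z0; transitivity (hyp2F1_continued z); last by rewrite /hyp2F1_continued z0.
have [cF aF] : is_hyp2F1 (- s) M%:R (1 - s) (hyp2F1 (- s) M%:R (1 - s)).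
  exact: (xgetPex _ (ex_intro _ _ hyp2F1_continued_spec)).
have [cG aG] := hyp2F1_continued_spec.
apply: (@analytic_identity R _ _ (-1) 1) => //; last by rewrite (lt_trans z0).
by move=> x; rewrite -ltr_norml => x1; apply: cvg_pseries_inj (cF _ x1) (cG _ x1).
Qed.

(** Since [M >= 1 >= 1 - s], the series in [w = z / (z - 1)] dominates the geometric one, whose sum
    [1 / (1 - w)] is [1 - z]. *)
Lemma pfaff_ge z : (0 < M)%N -> z < 0 -> (1 - z) ^- M * (1 - z) <= pfaff s M z.
Proof.
move=> M0 z0; have z1 : 0 < 1 - z by rewrite subr_gt0 (lt_trans z0).
rewrite /pfaff ler_wpM2l//; first by rewrite invr_ge0 exprn_ge0// ltW.
set w := z / (z - 1).
have w0 : 0 <= w by rewrite /w -mulrNN -invrN opprB divr_ge0// ?oppr_ge0 ltW.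
have w1 : w < 1.
  by rewrite /w -mulrNN -invrN opprB ltr_pdivrMr// mul1r; lra.
have nw1 : `|w| < 1 by rewrite ger0_norm.
have e : 1 - z = 1 / (1 - w).
  by rewrite /w; field; rewrite subr_eq0 lt_eqF ?(lt_trans z0)//=; lra.
have cgeo := @cvg_geometric_series R 1 w nw1.
rewrite e -(cvg_lim _ cgeo)// /pfaff_series /pseries; apply: lim_series_le => [||n /=].
- by apply/cvg_ex; eexists; exact: cgeo.
- exact: has_radius_pfaff.
rewrite ler_wpM2r ?exprn_ge0//.
rewrite /pfaff_coef ler_pdivlMr ?pochhammer_gt0 ?subr_gt0// mul1r.
rewrite /pochhammer; apply: ler_prod => j _; apply/andP; split.
  by rewrite addr_ge0// subr_ge0 ltW.
by rewrite lerD2r (le_trans (y := 1)) ?ler1n// gerBl ltW.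
Qed.

End HypergeometricContinuation.

(** * The product [Gamma (1 - s) * Gamma (1 + s)] *)

Section GammaIntegral.
Context {R : realType}.
Local Notation mu := (@lebesgue_measure R).
Local Notation J := (`]0, +oo[%classic : set R).

Lemma bigcup_itv_inv_nat :
  \bigcup_(n in [set: nat]) [set` `[(n.+2%:R)^-1 : R, n.+2%:R]] = J.
Proof.
apply/seteqP; split => [x [n _] /=|x /=].
  by rewrite !in_itv/= andbT => /andP[nx _]; rewrite (lt_le_trans _ nx)// invr_gt0.
rewrite in_itv/= andbT => x0.
exists (Num.truncn x + Num.truncn x^-1)%N => //=; rewrite in_itv/=.
have h y : 0 <= y -> y <= (Num.truncn y).+1%:R :> R by move=> _; exact/ltW/truncnS_gt.
have le1 : x <= (Num.truncn x + Num.truncn x^-1).+2%:R.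
  apply: (le_trans (h x (ltW x0))); rewrite ler_nat ltnS ltnW// ltnS.
  exact: leq_addr.
have le2 : x^-1 <= (Num.truncn x + Num.truncn x^-1).+2%:R.
  have x'0 : 0 <= x^-1 by rewrite invr_ge0 ltW.
  apply: (le_trans (h _ x'0)); rewrite ler_nat ltnS ltnW// ltnS.
  exact: leq_addl.
by rewrite le1 andbT -[leRHS]invrK lef_pV2// posrE// invr_gt0.
Qed.

(** Monotone convergence over the intervals [[1 / (n + 2), n + 2]]: an eventual bound on the
    increments of a primitive replaces the computation of its limits at both ends. *)
Lemma ge0_integral0y_le (f F : R -> R) (K : R) (N : nat) :
  (forall x : R, 0 < x -> 0 <= f x) ->
  (forall x : R, 0 < x -> {for x, continuous f}) ->
  (forall x : R, 0 < x -> is_derive x 1 F (f x)) ->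
  (forall n, (N <= n)%N -> F n.+2%:R - F (n.+2%:R^-1) <= K) ->
  (\int[mu]_(x in J) (f x)%:E <= K%:E)%E.
Proof.
move=> f0 cf dF FK; rewrite -bigcup_itv_inv_nat.
pose I n := [set` `[(n.+2%:R)^-1 : R, n.+2%:R]].
have I0 n x : I n x -> 0 < x.
  by rewrite /I/= in_itv/= => /andP[nx _]; rewrite (lt_le_trans _ nx)// invr_gt0.
have mf : measurable_fun J f.
  apply: open_continuous_measurable_fun => //.
  by move=> x; rewrite inE/= in_itv/= andbT => /cf.
have cint : (\int[mu]_(x in I n) (f x)%:E)%E @[n --> \oo] -->
            (\int[mu]_(x in \bigcup_n I n) (f x)%:E)%E.
  apply: ge0_nondecreasing_set_cvg_integral.
  - move=> m n mn; apply/subsetPset => x; rewrite /I/= !in_itv/= => /andP[mx xm].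
    apply/andP; split; last by rewrite (le_trans xm)// ler_nat !ltnS.
    by rewrite (le_trans _ mx)// lef_pV2 ?posrE// ler_nat !ltnS.
  - by move=> n; exact: measurable_itv.
  - move=> n; apply/measurable_EFinP; apply: measurable_funS mf => //.
    by move=> x /I0 x0; rewrite /= in_itv/= x0.
  - by move=> n x /I0 x0; rewrite lee_fin f0.
rewrite -(cvg_lim _ cint)//; apply: lime_le; first by apply/cvg_ex; eexists; exact: cint.
exists N => // n /= Nn.
(* The shift by two keeps the interval nondegenerate from [n = 0] on. *)
have n1 : (n.+2%:R)^-1 < n.+2%:R :> R.
  by apply: (@lt_trans _ _ 1); rewrite ?invf_lt1 ?ltr1n.
rewrite (@continuous_FTC2 _ f F)//.
- by rewrite -EFinB lee_fin FK.
- apply: continuous_in_subspaceT => x; rewrite inE => /I0 x0; exact: cf.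
- have dFn (t : R) : 0 < t -> derivable F t 1 by move=> /dF[].
  have cF (t : R) : 0 < t -> {for t, continuous F}.
    by move=> /dFn h; exact/differentiable_continuous/derivable1_diffP.
  split.
  + by move=> x /subset_itv_oo_cc /(I0 n) /dFn.
  + by apply: cvg_at_right_filter; apply: cF; rewrite invr_gt0.
  + by apply: cvg_at_left_filter; apply: cF.
- by move=> x /subset_itv_oo_cc /(I0 n) /dF[_ <-]; rewrite derive1E.
Qed.

Lemma Gamma1 : Gamma 1 = 1 :> R.
Proof.
rewrite /Gamma /Rintegral.
have -> : (\int[mu]_(x in J) (x `^ (1 - 1) * expR (- x))%:E = 1%:E)%E.
  under eq_integral do rewrite subrr powRr0 mul1r.
  have cE : continuous (fun x : R => expR (- x)).
    by move=> x; apply: continuous_comp; [exact: continuousN|exact: continuous_expR].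
  rewrite integral_itv_obnd_cbnd; last first.
    by apply/measurable_EFinP/measurable_funTS; exact: continuous_measurable_fun.
  rewrite (@ge0_continuous_FTC2y _ _ (fun x => - expR (- x)) _ 0).
  - by rewrite oppr0 expR0 EFinN oppeK add0e.
  - by move=> x _; exact: expR_ge0.
  - exact: continuous_subspaceT.
  - by rewrite -oppr0; apply: cvgN; exact: cvgr_expR.
  - by move=> x _; exact: ex_derive.
  - by apply: cvgN; apply: cvg_at_right_filter; exact: cE.
  - move=> x _; rewrite derive1E.
    have dn : is_derive x 1 (fun x : R => - expR (- x)) (expR (- x)).
      apply: (@is_derive_eq_val _ _ _ _ _ (@is_deriveN _ _ _ _ _ _ _
        (is_derive1_comp (g := -%R) (is_derive_expR (- x)) (is_deriveN (is_derive_id x 1))))).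
      by rewrite mulrN1 opprK.
    by have [_ ->] := dn.
by [].
Qed.

Lemma Gamma_ge0 (x : R) : 0 <= Gamma x.
Proof.
by rewrite /Gamma; apply: Rintegral_ge0 => t _; rewrite mulr_ge0// ?powR_ge0 ?expR_ge0.
Qed.

Lemma integral_mul_expR_le (c : R) : 0 < c ->
  (\int[mu]_(x in J) (x * expR (- (c * x)))%:E <= (c ^- 2)%:E)%E.
Proof.
move=> c0.
have dE (x : R) : is_derive x 1 (fun x : R => expR (- (c * x))) (- c * expR (- (c * x))).
  have dl : is_derive x 1 (fun x : R => - (c * x)) (- c).
    by apply: (is_derive_eq_val (is_deriveN (is_deriveZ c (is_derive_id x 1))));
      rewrite /GRing.scale/= mulr1.
  by apply: (is_derive_eq_val (is_derive1_comp (is_derive_expR _) dl)); rewrite mulrC.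
have cE (x : R) : {for x, continuous (fun x : R => expR (- (c * x)))}.
  by have [h _] := dE x; exact/differentiable_continuous/derivable1_diffP.
apply: (@ge0_integral0y_le _ (fun x => - ((x / c + c ^- 2) * expR (- (c * x)))) _ 0).
- by move=> x x0; rewrite mulr_ge0 ?expR_ge0// ltW.
- by move=> x _; apply: cvgM; [exact: cvg_id|exact: cE].
- move=> x _.
  have dl : is_derive x 1 (fun x : R => x / c + c ^- 2) (c^-1).
    apply: (is_derive_eq_val (is_deriveD
      (is_deriveM (is_derive_id x 1) (is_derive_cst (c^-1 : R) x 1))
      (is_derive_cst (c ^- 2 : R) x 1))).
    by rewrite /GRing.scale/= mulr0 add0r addr0 mulr1.
  apply: (is_derive_eq_val (is_deriveN (is_deriveM dl (dE x)))).
  by rewrite /GRing.scale/=; field; rewrite gt_eqF.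
- move=> n _; set z : R := n.+2%:R; set y := z^-1.
  have y0 : 0 < y by rewrite invr_gt0.
  have z0 : 0 < z by [].
  (* The term at the upper end is nonpositive and is dropped; the one at the lower end is bounded
     through [1 + c y <= exp (c y)]. *)
  rewrite /= opprK; apply: (@le_trans _ _ (0 + (y / c + c ^- 2) * expR (- (c * y)))).
    rewrite lerD2r oppr_le0 mulr_ge0 ?expR_ge0// addr_ge0// ?divr_ge0 ?invr_ge0 ?exprn_ge0// ltW//.
  rewrite add0r expRN ler_pdivrMr ?expR_gt0//.
  have -> : y / c + c ^- 2 = c ^- 2 * (1 + c * y) by field; rewrite gt_eqF.
  apply: ler_wpM2l; last exact: expR_ge1Dx.
  by rewrite invr_ge0 exprn_ge0// ltW.
Qed.

End GammaIntegral.

Section GammaReflection.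
Context {R : realType}.
Local Notation mu := (@lebesgue_measure R).
Local Notation J := (`]0, +oo[%classic : set R).
Variable s : R.
Hypotheses (s_gt0 : 0 < s) (s_lt1 : s < 1).

Lemma continuous_powR_gt0 (p y : R) : 0 < y -> {for y, continuous (fun y => y `^ p)}.
Proof.
move=> y0; apply/differentiable_continuous/derivable1_diffP.
by apply: derivable_powR; rewrite in_itv/= y0.
Qed.

Lemma powR_continuous_ge0 : {within `[0, +oo[, continuous (fun y : R => y `^ s)}.
Proof.
apply/continuous_within_itvcyP; split.
  by move=> y; rewrite in_itv/= andbT; exact: continuous_powR_gt0.
by rewrite powR0 ?gt_eqF//; exact: powR_cvg0.
Qed.

(** The substitution [y = x v] in the integral of [Gamma (1 + s)], with [x] the variable of the
    other Gamma integral: in the product all powers of [x] reduce to a single [x]. *)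
Lemma integral_powR_expR_scale (x : R) : 0 < x ->
  (\int[mu]_(y in J) (y `^ s * expR (- y))%:E =
   \int[mu]_(v in J) ((x * v) `^ s * expR (- (x * v)) * x)%:E)%E.
Proof.
move=> x0.
have dF (v : R) : is_derive v 1 (fun v : R => x * v) x.
  by apply: (is_derive_eq_val (is_deriveZ x (is_derive_id v 1))); rewrite /GRing.scale/= mulr1.
have F' : (fun v : R => x * v)^`()%classic = cst x.
  by apply/funext => v; rewrite derive1E; have [_ ->] := dF v.
have cF : continuous (fun v : R => x * v) by move=> v; exact: cvgMl_tmp.
have mG : measurable_fun setT (fun y : R => y `^ s * expR (- y)).
  by apply: measurable_funM => //; apply: measurableT_comp => //; exact: measurableT_comp.
rewrite !integral_itv_obnd_cbnd; last 2 first.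
- apply/measurable_EFinP/measurable_funTS; apply: measurable_funM => //.
  exact: (measurableT_comp mG).
- by apply/measurable_EFinP/measurable_funTS.
rewrite -{1}(mulr0 x) (@increasing_ge0_integration_by_substitutiony _ (fun v => x * v)).
- by apply: eq_integral => v _; rewrite F'.
- by move=> a b _ _ ab; rewrite ltr_pM2l.
- by rewrite F' => v _; exact: cvg_cst.
- by rewrite F'; exact: is_cvg_cst.
- by rewrite F'; exact: is_cvg_cst.
- split; first by move=> v _; have [] := dF v.
  by apply: cvg_at_right_filter; exact: cF.
- exact: (@gt0_cvgMry _ _ _ x id x0 (@cvg_id _ _)).
- rewrite mulr0 => v; apply: cvgM; first exact: powR_continuous_ge0.
  apply: continuous_subspaceT => w.
  by apply: continuous_comp; [exact: continuousN|exact: continuous_expR].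
- by move=> y _; rewrite mulr_ge0 ?powR_ge0 ?expR_ge0.
Qed.

(** [fine] sends an infinite integral to [0], so the bound passes to the real-valued [Gamma] without
    a convergence proof. *)
Lemma fineM_le (A B : \bar R) (K : R) : (0 <= A)%E -> (0 <= B)%E -> 0 <= K ->
  (A * B <= K%:E)%E -> fine A * fine B <= K.
Proof.
by case: A => [a| |]//; case: B => [b| |]//; rewrite /= ?mulr0 ?mul0r.
Qed.

(** The integrand [x v ^ s exp (- (1 + v) x)], extended by zero outside the open quadrant so that
    Tonelli's theorem applies on the whole plane. *)
Let h (z : R * R) : R :=
  Num.max z.1 0 * (Num.max z.2 0) `^ s * expR (- ((1 + z.2) * z.1)).

Let h_ge0 z : 0 <= h z.
Proof. by rewrite /h !mulr_ge0 ?powR_ge0 ?expR_ge0// le_max lexx orbT. Qed.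

Let measurable_h : measurable_fun setT h.
Proof.
apply: measurable_funM; first apply: measurable_funM.
- by apply: measurable_maxr => //; exact: measurable_fst.
- apply: (measurableT_comp (measurable_powR s)).
  by apply: measurable_maxr => //; exact: measurable_snd.
- apply: (measurableT_comp (@measurable_expR R)).
  apply: measurable_funN.
  apply: measurable_funM; last exact: measurable_fst.
  by apply: measurable_funD => //; exact: measurable_snd.
Qed.

Let integral_pos (f : R -> \bar R) : (forall x, x <= 0 -> f x = 0%E) ->
  (\int[mu]_x f x = \int[mu]_(x in J) f x)%E.
Proof.
move=> f0; rewrite [RHS]integral_mkcond; apply: eq_integral => x _.
rewrite patchE; case: ifPn => //; rewrite notin_setE/= in_itv/= andbT => /negP.
by rewrite -leNgt => /f0.
Qed.

Lemma Gamma_mul_integral_le (K : R) : 0 <= K ->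
  (\int[mu]_(v in J) (v `^ s / (1 + v) ^+ 2)%:E <= K%:E)%E ->
  Gamma (1 - s) * Gamma (1 + s) <= K.
Proof.
move=> K0 IK; rewrite /Gamma /Rintegral; apply: fineM_le => //.
- by apply: integral_ge0 => x _; rewrite lee_fin mulr_ge0 ?powR_ge0 ?expR_ge0.
- by apply: integral_ge0 => x _; rewrite lee_fin mulr_ge0 ?powR_ge0 ?expR_ge0.
apply: le_trans IK.
have -> : 1 + s - 1 = s by rewrite addrAC subrr add0r.
have -> : 1 - s - 1 = - s by rewrite addrAC subrr add0r.
rewrite -ge0_integralZr//; last 3 first.
- apply/measurable_EFinP/measurable_funTS; apply: measurable_funM => //.
  by apply: measurableT_comp => //; exact: measurableT_comp.
- by move=> x _; rewrite lee_fin mulr_ge0 ?powR_ge0 ?expR_ge0.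
- by apply: integral_ge0 => x _; rewrite lee_fin mulr_ge0 ?powR_ge0 ?expR_ge0.
have mexp c : measurable_fun setT (fun v : R => expR (- (c * v))).
  by apply: measurableT_comp => //; apply: measurableT_comp => //; exact: measurable_funM.
(* Equality in fact: [x ^ (- s) exp (- x)] times the rescaled integrand is [h]. After the exchange,
   the integral over [x] is at most [v ^ s / (1 + v) ^ 2]. *)
apply: (@le_trans _ _ (\int[mu]_x \int[mu]_v (h (x, v))%:E)%E).
  rewrite le_eqVlt; apply/orP; left; apply/eqP.
  rewrite [RHS]integral_pos; last first.
    move=> x x0; rewrite integral0_eq// => v _.
    by rewrite /h/= (max_idPr x0) !mul0r.
  apply: eq_integral => x; rewrite inE/= in_itv/= andbT => x0.
  rewrite [in RHS]integral_pos; last first.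
    by move=> v v0; rewrite /h/= (max_idPr v0) powR0 ?gt_eqF// mulr0 mul0r.
  rewrite (integral_powR_expR_scale x0) -ge0_integralZl//; last 3 first.
  - apply/measurable_EFinP/measurable_funTS; apply: measurable_funM => //.
    apply: measurable_funM; last exact: mexp.
    by apply: (measurableT_comp (measurable_powR s)); exact: measurable_funM.
  - by move=> v _; rewrite lee_fin !mulr_ge0 ?powR_ge0 ?expR_ge0// ltW.
  - by rewrite lee_fin mulr_ge0 ?powR_ge0 ?expR_ge0.
  apply: eq_integral => v; rewrite inE/= in_itv/= andbT => v0.
  rewrite -EFinM /h/= (max_idPl (ltW x0)) (max_idPl (ltW v0)); congr EFin.
  rewrite powRM ?ltW// powRN mulrDl mul1r opprD expRD (mulrC v).
  by field; rewrite gt_eqF// powR_gt0.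
have -> : (\int[mu]_x \int[mu]_v (h (x, v))%:E = \int[mu]_v \int[mu]_x (h (x, v))%:E)%E.
  have mh : measurable_fun setT (EFin \o h) by exact/measurable_EFinP.
  have := @fubini_tonelli _ _ _ _ R mu mu (EFin \o h) mh; apply => z.
  by rewrite lee_fin.
rewrite [leLHS]integral_pos; last first.
  move=> v v0; rewrite integral0_eq// => x _.
  by rewrite /h/= (max_idPr v0) powR0 ?gt_eqF// mulr0 mul0r.
apply: ge0_le_integral => //.
- by move=> v _; apply: integral_ge0 => x _; rewrite lee_fin.
- apply: measurable_funTS.
  apply: (measurable_fun_fubini_tonelli_G (m1 := mu) (fun z => (h z)%:E)).
    exact/measurable_EFinP.
  by move=> z; rewrite lee_fin.
- apply/measurable_EFinP.
  apply: open_continuous_measurable_fun => // v; rewrite inE/= in_itv/= andbT => v0.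
  apply: cvgM; first exact: continuous_powR_gt0.
  apply: cvgV; first by rewrite expf_neq0// gt_eqF// addr_gt0.
  apply: (@cvg_comp _ _ _ (fun v => 1 + v) (fun v => v ^+ 2)); last exact: exprn_continuous.
  by apply: cvgD; [exact: cvg_cst|exact: cvg_id].
- move=> v /=; rewrite in_itv/= andbT => v0.
  have v1 : 0 < 1 + v by rewrite addr_gt0.
  rewrite integral_pos; last first.
    by move=> x x0; rewrite /h/= (max_idPr x0) !mul0r.
  rewrite EFinM; apply: le_trans (lee_wpmul2l _ (integral_mul_expR_le v1)); last first.
    by rewrite lee_fin powR_ge0.
  rewrite -ge0_integralZl//; last 3 first.
  - apply/measurable_EFinP/measurable_funTS.
    by apply: measurable_funM; [exact: measurable_id|exact: mexp].
  - by move=> x; rewrite /= in_itv/= andbT => x0; rewrite lee_fin mulr_ge0 ?expR_ge0// ltW.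
  - by rewrite lee_fin powR_ge0.
  rewrite le_eqVlt; apply/orP; left; apply/eqP.
  apply: eq_integral => x; rewrite inE/= in_itv/= andbT => x0.
  rewrite -EFinM /h/= (max_idPl (ltW x0)) (max_idPl (ltW v0)); congr EFin.
  by rewrite mulrCA mulrA.
Qed.

End GammaReflection.

(** * Comparison of the Gamma product with the hypergeometric function for [M = 1] *)

Section GammaHypergeometric.
Context {R : realType}.
Variable s : R.
Hypotheses (s_gt0 : 0 < s) (s_lt1 : s < 1).
Local Notation G x := (pfaff s 1 (- x)).

Lemma pfaff1_ge1 (x : R) : 0 < x -> 1 <= G x.
Proof.
move=> x0; have x0' : - x < 0 by rewrite oppr_lt0.
have := @pfaff_ge _ s 1 s_gt0 s_lt1 (- x) (ltn0Sn 0) x0'.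
by rewrite opprK expr1 mulVf// gt_eqF// addr_gt0.
Qed.

Let phi (x : R) : R := x `^ (- s) * G x.

(** The weight [x ^ (- s)] cancels the homogeneous part of the equation; only the source term
    survives, and its sign makes [phi] decrease. *)
Lemma is_derive_phi (x : R) : 0 < x ->
  is_derive x 1 phi (- (s * x `^ (- s) / (x * (1 + x)))).
Proof.
move=> x0; have x0' : - x < 0 by rewrite oppr_lt0.
have dG := is_derive1_comp (g := -%R) (is_derive_pfaff 1 s_gt0 s_lt1 x0')
  (is_deriveN (is_derive_id x 1)).
apply: (is_derive_eq_val (is_deriveM (is_derive1_powR (- s) x0) dG)).
rewrite /GRing.scale/= opprK expr1 powRB; last by rewrite (gt_eqF x0) implybT.
rewrite powRr1 ?ltW//; field.
by rewrite !gt_eqF// addr_gt0.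
Qed.

Lemma phi_nonincreasing (x y : R) : 0 < x -> x <= y -> phi y <= phi x.
Proof.
move=> x0 xy; rewrite -lerN2.
apply: (@ler_is_derive_ge0 _ (fun z => - phi z) (fun z => s * z `^ (- s) / (z * (1 + z)))) => //.
move=> z /andP[xz _]; have z0 : 0 < z by apply: lt_le_trans xz.
split; first by apply: (is_derive_eq_val (is_deriveN (is_derive_phi z0))); rewrite opprK.
by rewrite divr_ge0// mulr_ge0// ?powR_ge0// ?addr_ge0// ltW.
Qed.

Lemma powRVN (x : R) : 0 < x -> x^-1 `^ (- s) = x `^ s.
Proof. by move=> /ltW x0; rewrite -powR_inv1// -powRrM mulN1r opprK. Qed.

Lemma integral_powR_div_le (x : R) : 0 < x ->
  (\int[lebesgue_measure]_(v in `]0%R, +oo[)  (v `^ s / (1 + v) ^+ 2)%:E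
     <= (phi x)%:E)%E.
Proof.
move=> x0.
(* A primitive of [v ^ s / (1 + v) ^ 2]: the derivative of [- phi (1 / v)] is [- s v ^ s / (1 + v)],
   which corrects that of [v ^ (s + 1) / (1 + v)]. *)
pose F (v : R) : R := v `^ (s + 1) / (1 + v) - phi v^-1.
have cont2 (v : R) : 0 < v -> {for v, continuous (fun v : R => (1 + v) ^- 2)}.
  move=> v0; apply: cvgV; first by rewrite expf_neq0// gt_eqF// addr_gt0.
  apply: (@cvg_comp _ _ _ (fun v : R => 1 + v) (fun v : R => v ^+ 2)); last exact: exprn_continuous.
  by apply: cvgD; [exact: cvg_cst|exact: cvg_id].
apply: (@ge0_integral0y_le _ _ F _ (Num.truncn x)).
- by move=> v v0; rewrite divr_ge0 ?powR_ge0// sqr_ge0.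
- by move=> v v0; apply: cvgM; [exact: continuous_powR_gt0|exact: cont2].
- move=> v v0; have v1 : 1 + v != 0 by rewrite gt_eqF// addr_gt0.
  have v'0 : 0 < v^-1 by rewrite invr_gt0.
  have d1 : is_derive v 1 (fun v : R => 1 + v) 1.
    by apply: (is_derive_eq_val (is_deriveD (is_derive_cst (1 : R) v 1) (is_derive_id v 1)));
    rewrite add0r.
  have dV := is_deriveV (f := fun v : R => 1 + v) v1 d1.
  have dI := is_deriveV (f := fun v : R => v) (lt0r_neq0 v0) (is_derive_id v 1).
  have dphi := is_derive1_comp (g := fun v : R => v^-1) (is_derive_phi v'0) dI.
  apply: (is_derive_eq_val (is_deriveB (is_deriveM (is_derive1_powR (s + 1) v0) dV) dphi)).
  rewrite /GRing.scale/= addrK powRD; last by rewrite (gt_eqF v0) implybT.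
  rewrite powRr1 ?ltW// (powRVN v0).
  by field; rewrite (gt_eqF v0) v1 ?[v + 1]addrC ?v1.
(* In [F y - F y^-1] the term [phi y] is at most [phi x] because [y >= x]; the boundary terms at [y]
   combine to something nonpositive by [pfaff1_ge1], and the last one enters with a minus sign. *)
- move=> n xn; set y : R := n.+2%:R; have y0 : 0 < y by [].
  have y'0 : 0 < y^-1 by rewrite invr_gt0.
  rewrite /F invrK.
  have h1 : phi y <= phi x.
    apply: phi_nonincreasing => //; apply: (le_trans (ltW (truncnS_gt x))).
    by rewrite ler_nat ltnS ltnW.
  have h2 : y `^ (s + 1) / (1 + y) <= phi y^-1.
    rewrite /phi (powRVN y0).
    apply: (@le_trans _ _ (y `^ s * 1)); last by rewrite ler_wpM2l ?powR_ge0// pfaff1_ge1.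
    rewrite powRD; last by rewrite (gt_eqF y0) implybT.
    rewrite (powRr1 (ltW y0)) -mulrA ler_wpM2l ?powR_ge0//.
    by rewrite ler_pdivrMr ?mul1r ?addr_gt0// lerDr.
  have h3 : 0 <= y^-1 `^ (s + 1) / (1 + y^-1).
    by rewrite divr_ge0 ?powR_ge0// addr_ge0// ltW.
  lra.
Qed.

Lemma Gamma_mul_le_hyp2F1 (x : R) : 0 < x ->
  Gamma (1 - s) * Gamma (1 + s) * x `^ s <= hyp2F1 (- s) 1 (1 - s) (- x).
Proof.
move=> x0; have x0' : - x < 0 by rewrite oppr_lt0.
rewrite (@hyp2F1_pfaff _ s 1 s_gt0 s_lt1 _ x0').
have p0 : 0 < x `^ s by rewrite powR_gt0.
rewrite -ler_pdivlMr// [leRHS]mulrC -powRN -/(phi x).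
apply: Gamma_mul_integral_le => //; last exact: integral_powR_div_le.
by rewrite mulr_ge0 ?powR_ge0// (le_trans ler01)// pfaff1_ge1.
Qed.

Lemma hyp2F1_ge1 (x : R) : 0 < x -> 1 <= hyp2F1 (- s) 1 (1 - s) (- x).
Proof.
move=> x0; have x0' : - x < 0 by rewrite oppr_lt0.
by rewrite (@hyp2F1_pfaff _ s 1 s_gt0 s_lt1 _ x0') pfaff1_ge1.
Qed.

Lemma hyp2F1_gt0 (M : nat) (x : R) : (0 < M)%N -> 0 < x ->
  0 < hyp2F1 (- s) M%:R (1 - s) (- x).
Proof.
move=> M0 x0; have x0' : - x < 0 by rewrite oppr_lt0.
rewrite (@hyp2F1_pfaff _ s M s_gt0 s_lt1 _ x0').
apply: lt_le_trans (pfaff_ge s_gt0 s_lt1 M0 x0').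
have x1 : 0 < 1 - - x by rewrite opprK addr_gt0.
by rewrite mulr_gt0// invr_gt0 exprn_gt0.
Qed.

End GammaHypergeometric.

(** * Water-filling *)

Section WaterFilling.
Context {R : realType}.
Implicit Types a b nu p q t x : R.

Lemma clip01_bounds x : 0 <= clip01 x <= 1.
Proof. by rewrite /clip01 le_max lexx orbT/= ge_max ge_min lexx orbT ler01. Qed.

Lemma clip01_continuous : continuous (@clip01 R).
Proof.
move=> x; rewrite /clip01.
have cid : {for x, continuous (fun y : R => y)} by exact: cvg_id.
have c1 : {for x, continuous (fun _ : R => (1 : R))} by exact: cvg_cst.
have c0 : {for x, continuous (fun _ : R => (0 : R))} by exact: cvg_cst.
exact: (continuous_max (continuous_min cid c1) c0).
Qed.

(* The derivative of [p q / (a + b q) - nu q] has the sign of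
   [(a + b t) ^ 2 - (a + b q) ^ 2], so its maximum over [0, 1] is at [clip01 t]. *)
Lemma waterfill_lt a b nu p q t : 0 < a -> 0 < b -> 0 < nu ->
  0 <= a + b * t -> p * a = nu * (a + b * t) ^+ 2 -> 0 <= q <= 1 -> q != clip01 t ->
  p * q / (a + b * q) - nu * q < p * clip01 t / (a + b * clip01 t) - nu * clip01 t.
Proof.
move=> a0 b0 nu0 X0 pa /andP[q0 q1] qr; have /andP[r0 r1] := clip01_bounds t.
set r := clip01 t in qr r0 r1 *.
have aq : 0 < a + b * q by rewrite ltr_pwDl// mulr_ge0// ltW.
have ar : 0 < a + b * r by rewrite ltr_pwDl// mulr_ge0// ltW.
(* Eliminating [p] through [p a = nu (a + b t) ^ 2] factors the gap; each of the cases [t < 0],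
   [t > 1] and [0 <= t <= 1] makes the numerator positive. *)
rewrite -subr_gt0 (_ : _ - _ =
    nu * ((q - r) * ((a + b * q) * (a + b * r) - (a + b * t) ^+ 2)) /
    ((a + b * q) * (a + b * r))); last first.
  rewrite (_ : p = nu * (a + b * t) ^+ 2 / a); last by rewrite -pa mulfK// gt_eqF.
  by field; rewrite !gt_eqF.
apply: divr_gt0; last exact: mulr_gt0.
apply: mulr_gt0 => //.
have [t0|t0] := ltP t 0.
  have r_eq : r = 0 by apply/max_idPr; rewrite ge_min (ltW t0).
  have {}q0 : 0 < q by rewrite lt_neqAle q0 andbT eq_sym -r_eq.
  rewrite r_eq subr0 mulr0 addr0 mulr_gt0// subr_gt0.
  apply: (@lt_le_trans _ _ (a ^+ 2)).
    by apply: ltrXn2r => //; rewrite ?nnegrE ?ltW// gtrDl pmulr_rlt0.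
  by rewrite expr2 (ler_wpM2r (ltW a0))// lerDl mulr_ge0// ltW.
have [t1|t1] := ltP 1 t.
  have r_eq : r = 1 by rewrite /r /clip01 (min_idPr (ltW t1)); exact/max_idPl.
  have {}q1 : q < 1 by rewrite lt_neqAle q1 andbT -r_eq.
  rewrite r_eq mulr1 nmulr_lgt0 ?subr_lt0//.
  apply: (@le_lt_trans _ _ ((a + b) ^+ 2)).
    have ab0 : 0 <= a + b by rewrite addr_ge0// ltW.
    rewrite expr2 (ler_wpM2r ab0)// lerD2l. by rewrite ger_pMr// ltW.
  have ab0 : 0 <= a + b by rewrite addr_ge0// ltW.
  by rewrite ltr_pXn2r ?nnegrE// ltrD2l ltr_pMr.
have r_eq : r = t by rewrite /r /clip01 (min_idPl t1); exact/max_idPl.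
rewrite r_eq in qr ar *.
rewrite (_ : _ * _ = (q - t) ^+ 2 * (b * (a + b * t))); last by ring.
by apply: mulr_gt0; [rewrite exprn_even_gt0//= subr_eq0|exact: mulr_gt0].
Qed.

(** The unclipped level is the stationary point: [a + b t] equals the square root of [p a / nu]. *)
Lemma waterfill_level a b nu p t : 0 <= a -> 0 < b -> 0 < nu -> 0 <= p ->
  t = Num.sqrt a / (Num.sqrt nu * b) * Num.sqrt p - a / b ->
  0 <= a + b * t /\ p * a = nu * (a + b * t) ^+ 2.
Proof.
move=> a0 b0 nu0 p0 ->.
have n0 : 0 < Num.sqrt nu by rewrite sqrtr_gt0.
rewrite (_ : a + _ = Num.sqrt a * Num.sqrt p / Num.sqrt nu); last first.
  by field; rewrite !gt_eqF.
split; first by rewrite divr_ge0 ?mulr_ge0 ?sqrtr_ge0.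
by rewrite expr_div_n exprMn !sqr_sqrtr ?(ltW nu0)//; field; rewrite gt_eqF.
Qed.

Section Maximizer.
Variables (N Nc : nat) (p : 'I_N -> R) (a b : R).
Hypotheses (p_gt0 : forall f, 0 < p f) (a_gt0 : 0 < a) (b_gt0 : 0 < b).

(** Weak duality: the slack [nu * (Nc - sum q)] is nonnegative on feasible points and zero at [r].
    Strictness in each single coordinate yields uniqueness. *)
Lemma waterfill_maximizer nu (r : 'rV[R]_N) : 0 < nu ->
  (forall f, r 0 f =
    clip01 (Num.sqrt a / (Num.sqrt nu * b) * Num.sqrt (p f) - a / b)) ->
  \sum_(f < N) r 0 f = Nc%:R ->
  is_maximizer (fun q : 'rV[R]_N => \sum_(f < N) p f * q 0 f / (a + b * q 0 f))
    (feasible Nc) r.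
Proof.
move=> nu0 rE rNc.
have lt_f q f : 0 <= q <= 1 -> q != r 0 f ->
    p f * q / (a + b * q) - nu * q < p f * r 0 f / (a + b * r 0 f) - nu * r 0 f.
  move=> q01; rewrite rE => qr.
  set t := (X in clip01 X) in qr *.
  have [t0 pa] := @waterfill_level a b nu (p f) t (ltW a_gt0) b_gt0 nu0 (ltW (p_gt0 f)) erefl.
  exact: waterfill_lt.
have le_f q f : 0 <= q <= 1 ->
    p f * q / (a + b * q) - nu * q <= p f * r 0 f / (a + b * r 0 f) - nu * r 0 f.
  by move=> q01; have [->//|qr] := eqVneq q (r 0 f); apply/ltW/lt_f.
have sumB (q : 'rV[R]_N) : \sum_(f < N) (p f * q 0 f / (a + b * q 0 f) - nu * q 0 f) =
    \sum_(f < N) p f * q 0 f / (a + b * q 0 f) - nu * \sum_(f < N) q 0 f.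
  by rewrite sumrB mulr_sumr.
have lagr (q : 'rV[R]_N) : feasible Nc q ->
    \sum_(f < N) p f * q 0 f / (a + b * q 0 f) <=
    \sum_(f < N) (p f * q 0 f / (a + b * q 0 f) - nu * q 0 f) + nu * Nc%:R.
  by move=> [qNc _]; rewrite sumB -addrA lerDl addrC subr_ge0 ler_wpM2l// ltW.
have rval : \sum_(f < N) (p f * r 0 f / (a + b * r 0 f) - nu * r 0 f) + nu * Nc%:R =
    \sum_(f < N) p f * r 0 f / (a + b * r 0 f).
  by rewrite sumB rNc subrK.
split.
- by split=> [|f]; [rewrite rNc|rewrite rE clip01_bounds].
- move=> q fq; apply: (le_trans (lagr q fq)); rewrite -rval lerD2r.
  by apply: ler_sum => f _; apply: le_f; have [] := fq.
- move=> q fq eq_q; apply/rowP => f; apply/eqP; apply: contraT => qr.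
  have [_ q01] := fq.
  have : \sum_(f < N) (p f * q 0 f / (a + b * q 0 f) - nu * q 0 f) + nu * Nc%:R <
      \sum_(f < N) (p f * r 0 f / (a + b * r 0 f) - nu * r 0 f) + nu * Nc%:R.
    rewrite ltrD2r (bigD1 f)//= [ltRHS](bigD1 f)//=.
    by rewrite ltr_leD ?lt_f//; apply: ler_sum => g _; apply: le_f.
  by rewrite rval -eq_q ltNge lagr.
Qed.

(** Intermediate values in the variable [x = 1 / sqrt nu], which makes the total continuous down to
    [x = 0], where every term is clipped to [0]. *)
Lemma waterfill_exists : (0 < Nc)%N -> (Nc <= N)%N ->
  exists nu, 0 < nu /\ \sum_(f < N)
    clip01 (Num.sqrt a / (Num.sqrt nu * b) * Num.sqrt (p f) - a / b) = Nc%:R.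
Proof.
move=> Nc0 NcN.
have sp0 f : 0 < Num.sqrt (p f) by rewrite sqrtr_gt0.
have sa0 : 0 < Num.sqrt a by rewrite sqrtr_gt0.
pose S (x : R) := \sum_(f < N) clip01 (Num.sqrt a * x / b * Num.sqrt (p f) - a / b).
have cS : continuous S.
  apply: continuous_big => [|f _ x]; first exact: add_continuous.
  pose lin (y : R) : R := Num.sqrt a * y / b * Num.sqrt (p f) - a / b.
  have cl : {for x, continuous lin}.
    apply: cvgB; last exact: cvg_cst.
    by apply: cvgMr_tmp; apply: cvgMr_tmp; apply: cvgMl_tmp; exact: cvg_id.
  exact: (continuous_comp cl (@clip01_continuous (lin x))).
have S0 : S 0 = 0.
  rewrite /S big1// => f _; rewrite mulr0 !mul0r sub0r /clip01; apply/max_idPr.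
  by rewrite ge_min oppr_le0 divr_ge0// ltW.
(* Each summand is the value of [x] at which one coordinate reaches [1]; their sum exceeds them all,
   so every coordinate is saturated at [X]. *)
pose X := \sum_(f < N) ((1 + a / b) * b / (Num.sqrt a * Num.sqrt (p f))).
have ab0 : 0 < 1 + a / b by rewrite addr_gt0// divr_gt0.
have X_ge f : (1 + a / b) * b / (Num.sqrt a * Num.sqrt (p f)) <= X.
  rewrite /X (bigD1 f)//= lerDl sumr_ge0// => g _.
  by rewrite divr_ge0// ltW// mulr_gt0.
have X0 : 0 <= X by rewrite sumr_ge0// => g _; rewrite divr_ge0// ltW// mulr_gt0.
have SX : S X = N%:R.
  rewrite /S (eq_bigr (fun=> 1)) ?sumr_const ?card_ord// => f _.
  have h : 1 <= Num.sqrt a * X / b * Num.sqrt (p f) - a / b.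
    rewrite lerBrDr; have := X_ge f; rewrite ler_pdivrMr ?mulr_gt0// => h.
    rewrite [leRHS](_ : _ = X * (Num.sqrt a * Num.sqrt (p f)) / b); last by ring.
    by rewrite ler_pdivlMr.
  by rewrite /clip01 (min_idPr h); exact/max_idPl.
have [||x x0X Sx] := @IVT R S 0 X Nc%:R X0.
- exact: continuous_subspaceT.
- by rewrite S0 SX ge_min ler0n/= le_max ler_nat NcN orbT.
have x0 : 0 < x.
  move: x0X; rewrite in_itv/= => /andP[x0 _]; rewrite lt_neqAle x0 andbT.
  apply/eqP => x_eq; move: Sx; rewrite -x_eq S0 => /eqP.
  by rewrite eq_sym pnatr_eq0 gtn_eqF.
exists (x ^- 2); split; first by rewrite invr_gt0 exprn_gt0.
rewrite -Sx; apply: eq_bigr => f _; congr (clip01 (_ * _ - _)).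
rewrite -exprVn sqrtr_sqr ger0_norm ?invr_ge0 ?ltW//.
by field; rewrite !gt_eqF.
Qed.

End Maximizer.
End WaterFilling.

(** * The caching problem *)

Section SystemModel.
Context {R : realType}.
Variables (s : params R) (Nf Nc : nat).
Hypotheses (hlambda1 : 0 < lambda1 s) (hlambda2 : 0 < lambda2 s)
  (hlambdau : 0 < lambdau s) (hP1 : 0 < P1 s) (hP2 : 0 < P2 s)
  (hB1 : 0 < B1 s) (hB2 : 0 < B2 s) (hgamma0 : 0 < gamma0 s)
  (halpha : 2 < alpha s) (hM1 : (1 <= M1 s)%N) (hM2 : M2 s = 1%N).

Lemma exponent_gt0 : 0 < 2 / alpha s.
Proof. by rewrite divr_gt0// (lt_trans _ halpha). Qed.

Lemma exponent_lt1 : 2 / alpha s < 1.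
Proof. by rewrite ltr_pdivrMr ?mul1r// (lt_trans _ halpha). Qed.

Lemma kappa_gt0 : 0 < kappa s.
Proof.
by apply: mulr_gt0; [exact: divr_gt0|rewrite powR_gt0// mulr_gt0// divr_gt0].
Qed.

Lemma C1_gt0 : 0 < C1 s.
Proof.
rewrite /C1 mulr_gt0 ?kappa_gt0//; apply: hyp2F1_gt0 => //.
- exact: exponent_gt0.
- exact: exponent_lt1.
- by rewrite divr_gt0// mulr_gt0// /M12 /B12 ?divr_gt0// ?hM2 ltr0n.
Qed.

Lemma C2_ge0 : 0 <= C2 s.
Proof. by rewrite /C2 mulr_ge0 ?powR_ge0// divr_ge0 ?mulr_ge0 ?Gamma_ge0. Qed.

Lemma C3_ge : -1 <= C3 s.
Proof.
rewrite /C3 /C2 hM2 Gamma1 divr1 lerBrDr addNr subr_ge0.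
by apply: Gamma_mul_le_hyp2F1; [exact: exponent_gt0|exact: exponent_lt1|].
Qed.

Lemma C2D3_ge0 : 0 <= C2 s + C3 s.
Proof.
rewrite /C3 hM2 addrA (addrC (C2 s)) subrK subr_ge0.
by apply: hyp2F1_ge1; [exact: exponent_gt0|exact: exponent_lt1|].
Qed.

Lemma popularity_gt0 (f : 'I_Nf) : 0 < popularity s f.
Proof.
rewrite /popularity divr_gt0 ?powR_gt0//.
by rewrite (bigD1 f)//= ltr_pwDl ?powR_gt0// sumr_ge0.
Qed.

Lemma q_oE (mu : R) : 0 < mu -> forall f, q_o s Nf mu 0 f =
  clip01 (Num.sqrt (kappa s) / (Num.sqrt mu * 1) * Num.sqrt (popularity s f) - kappa s / 1).
Proof.
by move=> mu0 f; rewrite mxE mulr1 divr1 sqrtrM ?sqrtrV ?ltW// ?kappa_gt0.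
Qed.

(** The explicit factor [1] presents the sum as a water-filling objective with [a = kappa] and
    [b = 1]. *)
Definition load (q : 'rV[R]_Nf) : R :=
  \sum_(f < Nf) popularity s f * q 0 f / (kappa s + 1 * q 0 f).

Lemma active_probE (q : 'rV[R]_Nf) : active_prob s q =
  1 - (1 + lambdau s / (7 / 2 * lambda2 s) * load q) `^ (- (7 / 2)).
Proof. by rewrite /active_prob /load; under [in RHS]eq_bigr do rewrite mul1r. Qed.

Lemma load_factor_gt0 : 0 < lambdau s / (7 / 2 * lambda2 s).
Proof. by rewrite divr_gt0// mulr_gt0// divr_gt0. Qed.

Lemma load_ge0 (q : 'rV[R]_Nf) : feasible Nc q -> 0 <= load q.
Proof.
move=> [_ q01]; apply: sumr_ge0 => f _; have /andP[q0 _] := q01 f.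
have [k0 p0] := (kappa_gt0, popularity_gt0 f).
by rewrite mul1r; apply: divr_ge0; [rewrite mulr_ge0// ltW|rewrite addr_ge0// ltW].
Qed.

Lemma active_prob_le (q q' : 'rV[R]_Nf) : feasible Nc q -> load q <= load q' ->
  active_prob s q <= active_prob s q'.
Proof.
move=> fq qq'; rewrite !active_probE lerD2l lerN2 !powRN.
have c0 := load_factor_gt0; have l0 := load_ge0 fq.
have h1 : 0 < 1 + lambdau s / (7 / 2 * lambda2 s) * load q.
  by rewrite ltr_pwDl// mulr_ge0// ltW.
have h2 : 1 + lambdau s / (7 / 2 * lambda2 s) * load q <=
          1 + lambdau s / (7 / 2 * lambda2 s) * load q'.
  by rewrite lerD2l ler_pM2l.
have h3 : 0 < 1 + lambdau s / (7 / 2 * lambda2 s) * load q' by apply: lt_le_trans h2.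
rewrite lef_pV2 ?posrE ?powR_gt0//.
by apply: ge0_ler_powR => //; rewrite ?nnegrE ?ltW.
Qed.

Lemma active_prob_bounds (q : 'rV[R]_Nf) : feasible Nc q -> 0 <= active_prob s q < 1.
Proof.
move=> fq; rewrite active_probE powRN.
have h : 1 <= 1 + lambdau s / (7 / 2 * lambda2 s) * load q.
  by rewrite lerDl mulr_ge0 ?load_ge0// ltW// load_factor_gt0.
have h0 := lt_le_trans ltr01 h.
rewrite subr_ge0 invf_le1 ?powR_gt0// gtrBl invr_gt0 powR_gt0// andbT.
by rewrite -[leLHS](powRr0 (1 + lambdau s / (7 / 2 * lambda2 s) * load q)) ler_powR.
Qed.

(** The second claim combines [C3 >= - 1] with the strict bound on [pbar]:
    [pbar * C3 + 1 >= 1 - pbar]. *)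
Lemma P_off_lower_coef_gt0 (pbar : R) : 0 <= pbar < 1 ->
  0 < C1 s + pbar * C2 s /\ 0 < pbar * C3 s + 1.
Proof.
move=> /andP[p0 p1]; split.
  by rewrite ltr_pwDl ?C1_gt0// mulr_ge0// C2_ge0.
have := C3_ge; nra.
Qed.

Lemma P_off_lower_le pbar (q : 'rV[R]_Nf) : feasible Nc q -> pbar < 1 ->
  active_prob s q <= pbar -> P_off_lower s pbar q <= P_off s q.
Proof.
move=> fq pbar1 ppbar; have /andP[p0 p1] := active_prob_bounds fq.
set p := active_prob s q in ppbar p0 p1 *.
apply: ler_sum => f _; have /andP[q0 q1] := fq.2 f.
set x := q 0 f in q0 q1 *.
(* The coefficient of the active probability in the denominator is affine in [x], so on [0, 1] it
   lies between its end values [C2] and [C2 + C3]. *)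
have C23 : 0 <= C2 s + C3 s * x.
  rewrite (_ : _ + _ = (1 - x) * C2 s + x * (C2 s + C3 s)); last by ring.
  by rewrite addr_ge0// mulr_ge0 ?C2_ge0 ?C2D3_ge0// subr_ge0.
have h1 : 0 < C1 s + C2 s * p + C3 s * p * x + x.
  rewrite (_ : _ + _ = C1 s + (p * (C2 s + C3 s * x) + x)); last by ring.
  by rewrite ltr_pwDl ?C1_gt0// addr_ge0// mulr_ge0.
have h2 : C1 s + C2 s * p + C3 s * p * x + x <= C1 s + pbar * C2 s + (pbar * C3 s + 1) * x.
  rewrite -subr_ge0 (_ : _ - _ = (pbar - p) * (C2 s + C3 s * x)); last by ring.
  by rewrite mulr_ge0// subr_ge0.
have h3 := lt_le_trans h1 h2.
apply: ler_wpM2l; last by rewrite lef_pV2 ?posrE.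
by rewrite mulr_ge0// ltW// popularity_gt0.
Qed.

End SystemModel.

Theorem mainTheorem4 (R : realType) (s : params R) (Nf Nc : nat)
    (hlambda1 : 0 < lambda1 s) (hlambda2 : 0 < lambda2 s)
    (hlambdau : 0 < lambdau s)
    (hP1 : 0 < P1 s) (hP2 : 0 < P2 s) (hB1 : 0 < B1 s) (hB2 : 0 < B2 s)
    (hgamma0 : 0 < gamma0 s) (halpha : 2 < alpha s)
    (hM1 : (1 <= M1 s)%N) (hM2 : M2 s = 1%N)
    (hdelta : 0 < delta s)
    (hNc : (1 <= Nc)%N) (hNcNf : (Nc <= Nf)%N) :
  (exists mu : R, 0 < mu /\ \sum_(f < Nf) q_o s Nf mu 0 f = Nc%:R) /\
  forall mu : R, 0 < mu -> \sum_(f < Nf) q_o s Nf mu 0 f = Nc%:R ->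
    let pbar := active_prob s (q_o s Nf mu) in
    (forall q : 'rV[R]_Nf, feasible Nc q ->
       active_prob s q <= pbar /\ P_off_lower s pbar q <= P_off s q) /\
    (exists nu : R, 0 < nu /\ \sum_(f < Nf) q_star s Nf pbar nu 0 f = Nc%:R) /\
    (forall nu : R, 0 < nu -> \sum_(f < Nf) q_star s Nf pbar nu 0 f = Nc%:R ->
       is_maximizer (P_off_lower s pbar) (feasible Nc) (q_star s Nf pbar nu)).
Proof.
have pop0 := @popularity_gt0 R s Nf.
have k0 : 0 < kappa s by exact: kappa_gt0.
split.
  have [mu [mu0 muNc]] := waterfill_exists pop0 k0 ltr01 hNc hNcNf.
  exists mu; split=> //; rewrite -muNc; apply: eq_bigr => f _.
  exact: q_oE.
move=> mu mu0 muNc pbar.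
have q_oE' : forall f, _ := @q_oE R s Nf hlambda1 hlambda2 hP1 hP2 hB1 hB2 mu mu0.
(* Water-filling here maximizes [load]; the active probability is an increasing function of it, so
   the maximum carries over to [pbar]. *)
have [feas_o max_o _] := waterfill_maximizer pop0 k0 ltr01 mu0 q_oE' muNc.
have pbar01 : 0 <= pbar < 1 by apply: active_prob_bounds feas_o.
have [A0 B0] : 0 < C1 s + pbar * C2 s /\ 0 < pbar * C3 s + 1 by exact: P_off_lower_coef_gt0.
split=> [q fq|].
  have qp : active_prob s q <= pbar.
    by apply: (active_prob_le _ _ _ _ _ _ _ fq) => //; exact: max_o.
  by split=> //; have /andP[_ pbar1] := pbar01;
    apply: (P_off_lower_le _ _ _ _ _ _ _ _ _ _ _ fq pbar1 qp).
split=> [|nu nu0 nuNc].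
  have [nu [nu0 nuNc]] := waterfill_exists pop0 A0 B0 hNc hNcNf.
  by exists nu; split=> //; rewrite -nuNc; apply: eq_bigr => f _; rewrite mxE.
have q_starE f : q_star s Nf pbar nu 0 f = clip01 (Num.sqrt (C1 s + pbar * C2 s) /
    (Num.sqrt nu * (pbar * C3 s + 1)) * Num.sqrt (popularity s f) -
    (C1 s + pbar * C2 s) / (pbar * C3 s + 1)) by rewrite mxE.
exact: (waterfill_maximizer pop0 A0 B0 nu0 q_starE nuNc).
Qed.
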